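(* Let $(a_k)_{k\ge 0}$ be i.i.d. positive random variables and let $\alpha_k=\ln a_k$. Assume the distribution of $\alpha_k$ is non-lattice and has finite third absolute moment, and let $\mu_\alpha=\mathbb{E}[\alpha_k]$. Let $x_0=1$ and $x_{k+1}=a_kx_k$ for $k=0,1,2,\dots$, so that $x_K=\prod_{k=0}^{K-1}a_k$. Then \[ \lim_{K\to\infty}\operatorname{median}(x_K)=0\quad\iff\quad \mu_\alpha<0. \]
   Context: A distribution of a real random variable $\alpha$ is a lattice distribution if there exist $b\in\mathbb{R}$ and $h>0$ such that $\mathbb{P}\{\alpha\in b+h\mathbb{Z}\}=1$; non-lattice means it is not lattice. $\operatorname{median}(Y)$ denotes the median of the distribution of $Y$. The initial state is normalised to $x_0=1$ (a standing assumption of the paper). *)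

(* Defs.v *)
From HB Require Import structures.
From mathcomp Require Import all_boot all_order all_algebra.
From mathcomp Require Import all_classical all_reals all_analysis.
Set Implicit Arguments. Unset Strict Implicit. Unset Printing Implicit Defensive.
Import Order.TTheory GRing.Theory Num.Theory.
Import numFieldNormedType.Exports.
Local Open Scope classical_set_scope.
Local Open Scope ring_scope.

Section Defs.
Context {d : measure_display} {T : measurableType d} {R : realType}.
Variable P : probability T R.

Definition mutually_independent (X : nat -> T -> R) : Prop :=
  forall (J : seq nat) (B : nat -> set R),
    uniq J -> (forall j, measurable (B j)) ->
    P (\big[setI/setT]_(j <- J) (X j @^-1` B j)) =
    (\prod_(j <- J) P (X j @^-1` B j))%E.

Definition identically_distributed (X : nat -> T -> R) : Prop :=
  forall k (B : set R), measurable B -> P (X k @^-1` B) = P (X 0%N @^-1` B).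

Definition iid (X : nat -> T -> R) : Prop :=
  (forall k, measurable_fun setT (X k)) /\
  mutually_independent X /\ identically_distributed X.

Definition lattice_distributed (Y : T -> R) : Prop :=
  exists b h : R, 0 < h /\
    P [set w | exists z : int, Y w = b + z%:~R * h] = 1%E.

Definition is_median (Y : T -> R) (m : R) : Prop :=
  ((1 / 2)%:E <= P [set w | (Y w <= m)%R])%E /\
  ((1 / 2)%:E <= P [set w | (m <= Y w)%R])%E.

End Defs.

(* Main.v *)
(** Let [S n] be the sum of the first [n] logarithms, centered at their mean.
    If the mean is negative, Chebyshev's inequality puts the median of the
    product below any threshold.  Otherwise it suffices to find [B] such that
    [P (S n <= - B) < 1/2] for infinitely many [n], which is a statement at the
    scale of the Berry-Esseen error.  It is obtained from a minorant [H] of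
    [c * sgn] whose Fourier transform lives on [[-1, 1]]: by Fubini,
    [E H (S n + M)] is an integral over [0 < t <= 1] of the characteristic
    function of [S n].  After rescaling, for [n = 6 m + 2] it is at most
    [1 / (1 + m v t^2)] on this range, and since the first moment vanishes
    and the third is finite its imaginary part is [O(n t^3)] times such a
    factor.  Hence the shift by [M] contributes a positive term of order
    [M / sqrt n], while every other contribution is [O(1 / sqrt n)] uniformly
    in [M] or [o(1 / sqrt n)] for fixed [M]; a large [M] makes
    [E H (S n + M)], and therefore [P (S n > - M) - P (S n <= - M)], positive.
    Non-latticeness enters through the positivity of the variance. *)
Require Import Defs.
From HB Require Import structures.
From mathcomp Require Import all_boot all_order all_algebra.
From mathcomp Require Import all_classical all_reals all_analysis.
From mathcomp Require Import measurable_realfun zify ring lra.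
Set Implicit Arguments. Unset Strict Implicit. Unset Printing Implicit Defensive.
Import Order.TTheory GRing.Theory Num.Theory.
Import numFieldNormedType.Exports.
Local Open Scope classical_set_scope.
Local Open Scope ring_scope.

(** When the mean vanishes, the central limit theorem is too coarse: for each fixed [B] the
    probability of [S n <= - B] tends to 1/2, and the question is whether it does so from below.
    That is decided at order [1 / sqrt n], where an Edgeworth expansion would require control of the
    characteristic function far from 0. Two freedoms avoid this. The variables may be multiplied by
    a small constant, which only divides the threshold [B]; after that the Taylor expansion at 0 is
    accurate on the whole band [0 < t <= 1], and the band limit of the minorant hides all other
    frequencies. And [B] may be large, so the skewness term and the loss in the minorant are not
    computed but outweighed by a shift [M] chosen after their constants. Working with a minorant
    rather than an approximation keeps every inequality one-sided, so atoms of [S n] create no error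
    term. A subsequence of indices is enough, since medians tending to 0 would be below [exp (- B)]
    for all large [n]. *)

Definition indep2 d (T : measurableType d) (R : realType) (P : probability T R)
    (X Y : T -> R) :=
  forall A B : set R, measurable A -> measurable B ->
    P (X @^-1` A `&` Y @^-1` B) = (P (X @^-1` A) * P (Y @^-1` B))%E.

(** * Product laws of independent pairs *)

Section independent_pairs.
Local Open Scope ereal_scope.
Context d (T : measurableType d) (R : realType) (P : probability T R).

(** A measure that factorizes on rectangles is the product measure; the factor [P E] is absorbed
    into the second marginal. The event [E] is a bystander: in the induction on partial sums it
    carries the constraints on later variables. *)
Lemma joint_law (X Y : {mfun T >-> R}) (E : set T) : measurable E ->
  (forall A B : set R, measurable A -> measurable B ->
    P (X @^-1` A `&` Y @^-1` B `&` E) =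
    P (X @^-1` A) * P (Y @^-1` B) * P E) ->
  forall C : set (R * R), measurable C ->
    P ([set w | C (X w, Y w)] `&` E) =
    P E * (distribution P X \x distribution P Y) C.
Proof.
move=> mE XYE C mC.
have finE : P E \is a fin_num by rewrite fin_num_measure.
have p0 : (0 <= fine (P E))%R by rewrite fine_ge0.
pose p := NngNum p0.
have mXY : measurable_fun setT (fun w => (X w, Y w)).
  by apply/measurable_fun_pairP; split => //=.
pose push : {measure set (R * R) -> \bar R} :=
  pushforward (mrestr P mE) (fun w => (X w, Y w)).
pose m' := push mXY.
pose ms : {measure set (R * R) -> \bar R} :=
  mscale p (distribution P X \x distribution P Y).
have pE : (p%:num)%:E = P E by rewrite /= fineK.
have -> : P E * (distribution P X \x distribution P Y) C = ms C.
  by rewrite -pE.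
have -> : P ([set w | C (X w, Y w)] `&` E) = m' C by [].
pose dY : {sigma_finite_measure set R -> \bar R} := mscale p (distribution P Y).
have dYE B : dY B = P E * P (Y @^-1` B) by rewrite -pE.
have msE D : ms D = P E * (distribution P X \x distribution P Y) D by rewrite -pE.
rewrite -(@product_measure_unique _ _ _ _ R (distribution P X) dY m')//; last first.
  move=> A B mA mB; rewrite dYE /m'/= /pushforward /mrestr/=.
  rewrite (_ : _ @^-1` _ = X @^-1` A `&` Y @^-1` B)// XYE//.
  by rewrite muleA muleAC.
rewrite (@product_measure_unique _ _ _ _ R (distribution P X) dY ms)//.
move=> A B mA mB; rewrite msE dYE product_measure1E//.
by rewrite muleCA.
Qed.

Lemma indep2_law (X Y : {mfun T >-> R}) : indep2 P X Y ->
  forall C : set (R * R), measurable C ->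
    P [set w | C (X w, Y w)] = (distribution P X \x distribution P Y) C.
Proof.
move=> XY C mC; have := @joint_law X Y setT measurableT _ C mC.
rewrite setIT probability_setT mul1e; apply => A B mA mB.
by rewrite setIT mule1; exact: XY.
Qed.

(** Tonelli on absolute values gives integrability under the product law, then Fubini gives the
    value; both are transported along the joint law. *)
Lemma indep2_integralM (X Y : {mfun T >-> R}) : indep2 P X Y ->
  P.-integrable setT (EFin \o X) -> P.-integrable setT (EFin \o Y) ->
  P.-integrable setT (fun w => (X w * Y w)%:E) /\
  \int[P]_w (X w * Y w)%:E = (\int[P]_w (X w)%:E) * (\int[P]_w (Y w)%:E).
Proof.
move=> XY iX iY.
have mXY : measurable_fun setT (fun w => (X w, Y w)).
  by apply/measurable_fun_pairP; split => //=.
pose XYf : {mfun T >-> (R * R)%type} := mfun_Sub (mem_set mXY).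
pose f (z : R * R) : \bar R := (z.1 * z.2)%:E.
have mf : measurable_fun setT f.
  by apply/measurable_EFinP; apply: measurable_funM.
have absE : \int[distribution P X \x distribution P Y]_z `|f z| =
    (\int[P]_w `|(X w)%:E|) * (\int[P]_w `|(Y w)%:E|).
  rewrite fubini_tonelli1//; last exact: measurableT_comp.
  rewrite /fubini_F/=.
  under eq_integral => x _.
    under eq_integral => y _ do rewrite /f/= normrM EFinM.
    rewrite ge0_integralZl//; last first.
      exact: measurableT_comp.
    rewrite (_ : \int[_]_y _ = \int[P]_w `|(Y w)%:E|); last first.
      by rewrite ge0_integral_distribution//; exact: measurableT_comp.
    over.
  rewrite ge0_integralZr//.
  - by rewrite ge0_integral_distribution//; exact: measurableT_comp.
  - exact: measurableT_comp.
  - by apply: integral_ge0.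
have fiX : \int[P]_w `|(X w)%:E| \is a fin_num.
  by rewrite ge0_fin_numE ?integral_ge0//; case/integrableP : iX.
have fiY : \int[P]_w `|(Y w)%:E| \is a fin_num.
  by rewrite ge0_fin_numE ?integral_ge0//; case/integrableP : iY.
have lawE A : measurable A -> distribution P XYf A =
    (distribution P X \x distribution P Y) A.
  by move=> mA; rewrite -indep2_law.
have ifp : (distribution P X \x distribution P Y).-integrable setT f.
  apply/integrableP; split=> //; rewrite absE.
  by rewrite -ge0_fin_numE ?mule_ge0 ?integral_ge0// fin_numM.
have iXY : P.-integrable setT (f \o XYf).
  apply/integrableP; split; first exact: measurableT_comp.
  rewrite -(ge0_integral_distribution XYf (f := fun z => `|f z|))//; last first.
    exact: measurableT_comp.
  rewrite (eq_measure_integral (distribution P X \x distribution P Y)); last first.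
    by move=> A mA _; exact: lawE.
  by case/integrableP : ifp.
split; first exact: iXY.
rewrite (_ : \int[P]_w _ = \int[P]_w (f \o XYf) w)//.
rewrite -integral_distribution//.
rewrite (eq_measure_integral (distribution P X \x distribution P Y)); last first.
  by move=> A mA _; exact: lawE.
rewrite -integral12_prod_meas1// /fubini_F/=.
have iY' : (distribution P Y).-integrable setT EFin.
  by apply: integrable_pushforward => //=; exact: measurable_funP.
have iX' : (distribution P X).-integrable setT EFin.
  by apply: integrable_pushforward => //=; exact: measurable_funP.
under eq_integral => x _.
  under eq_integral => y _ do rewrite /f/= EFinM.
  rewrite integralZl//.
  rewrite (_ : \int[_]_y _ = \int[P]_w (Y w)%:E); last first.
    by rewrite integral_distribution.
  over.
rewrite /=.
have -> : \int[P]_w (Y w)%:E = (fine (\int[P]_w (Y w)%:E))%:E.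
  by rewrite fineK//; exact: integrable_fin_num.
rewrite integralZr//; congr (_ * _).
by rewrite integral_distribution.
Qed.

End independent_pairs.

(** * Partial sums and later variables *)

Section independent_sums.
Local Open Scope ereal_scope.
Context d (T : measurableType d) (R : realType) (P : probability T R).
Variable X : nat -> T -> R.
Hypothesis mX : forall k, measurable_fun setT (X k).
Hypothesis indepX : mutually_independent P X.

Let S n w : R := (\sum_(k < n) X k w)%R.

Let mS n : measurable_fun setT (S n).
Proof. exact: measurable_sum. Qed.

Let mpre (Y : T -> R) (A : set R) : measurable_fun setT Y -> measurable A ->
  measurable (Y @^-1` A).
Proof. by move=> mY mA; rewrite -[X in measurable X]setTI; exact: mY. Qed.

(** Independence of [S n] and [X n] alone does not pass through the induction: once [X n] is
    absorbed into the sum, the remaining constraints on later variables must still factor out, hence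
    the list [J]. *)
Lemma sum_indep_future n (A : set R) (J : seq nat) (B : nat -> set R) :
  measurable A -> uniq J -> all (leq n) J -> (forall j, measurable (B j)) ->
  P (S n @^-1` A `&` \big[setI/setT]_(j <- J) (X j @^-1` B j)) =
  P (S n @^-1` A) * P (\big[setI/setT]_(j <- J) (X j @^-1` B j)).
Proof.
elim: n A J B => [|n IH] A J B mA uJ nJ mB.
  have -> : S 0 = cst 0%R by apply/funext => w; rewrite /S big_ord0.
  rewrite preimage_cst; case: ifPn => _.
    by rewrite setTI probability_setT mul1e.
  by rewrite set0I measure0 mul0e.
pose C := [set z : R * R | A (z.1 + z.2)%R].
have mC : measurable C.
  have mD : measurable_fun setT (fun z : R * R => z.1 + z.2)%R.
    exact: measurable_funD.
  by rewrite -[X in measurable X]setTI; exact: mD.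
pose Sn : {mfun T >-> R} := mfun_Sub (mem_set (mS n)).
pose Xn : {mfun T >-> R} := mfun_Sub (mem_set (mX n)).
have SSE : S n.+1 @^-1` A = [set w | C (Sn w, Xn w)].
  by apply/seteqP; split => w; rewrite /C/= /S big_ord_recr.
have key K : uniq K -> all (leq n.+1) K ->
    P (S n.+1 @^-1` A `&` \big[setI/setT]_(j <- K) (X j @^-1` B j)) =
    P (\big[setI/setT]_(j <- K) (X j @^-1` B j)) *
    (distribution P Sn \x distribution P Xn) C.
  move=> uK nK; rewrite SSE; apply: joint_law => //.
    by apply: big_ind => //; [exact: measurableI | move=> j _; exact: mpre].
  move=> A1 B1 mA1 mB1.
  (* Splicing the constraint on [X n] into the family lets the induction hypothesis apply to the
     list [n :: K]. *)
  pose B' j := if j == n then B1 else B j.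
  have mB' j : measurable (B' j) by rewrite /B'; case: ifP.
  have nK' : n \notin K.
    by apply/negP => /(allP nK); rewrite ltnn.
  have BE : \big[setI/setT]_(j <- K) (X j @^-1` B j) =
      \big[setI/setT]_(j <- K) (X j @^-1` B' j).
    apply: eq_big_seq => j jK; rewrite /B'; case: eqP => // jn.
    by move: nK'; rewrite -jn jK.
  have uK' : uniq (n :: K) by rewrite /= nK'.
  have nK1 : all (leq n) (n :: K).
    by rewrite /= leqnn; apply: sub_all nK => j; exact: ltnW.
  have BnE : X n @^-1` B1 = X n @^-1` B' n by rewrite /B' eqxx.
  have := IH A1 (n :: K) B' mA1 uK' nK1 mB'.
  rewrite BE !big_cons -setIA -BnE => ->.
  have := indepX uK' mB'; rewrite !big_cons -BnE => ->.
  by rewrite (indepX uK mB') muleA.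
(* The empty list identifies the product law of [C] with the probability of the event on
   [S n.+1]. *)
rewrite key//; have := key [::] isT isT.
by rewrite big_nil setIT probability_setT mul1e => ->; rewrite muleC.
Qed.

Lemma sum_indep_next n : indep2 P (S n) (X n).
Proof.
move=> A B mA mB.
have := @sum_indep_future n A [:: n] (fun=> B) mA isT.
by rewrite /= leqnn big_seq1 => -> //.
Qed.

End independent_sums.

(** * Rules of differentiation *)

Section pointwise_derivatives.
Context {R : realType}.
Implicit Types (f g : R -> R) (x a b c : R).

(* Not a class, so that derivatives of lambda-abstractions can be computed by
   goal-directed application of the rules below. *)
Definition has_der f x a := is_derive x 1 f a.

Lemma der_eq f x a b : has_der f x a -> a = b -> has_der f x b.
Proof. by move=> ? <-. Qed.

Lemma der_cst c x : has_der (fun _ : R => c) x 0.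
Proof. exact: is_derive_cst. Qed.

Lemma der_id x : has_der (fun y : R => y) x 1.
Proof. exact: is_derive_id. Qed.

Lemma derD f g x a b : has_der f x a -> has_der g x b ->
  has_der (fun y => f y + g y) x (a + b).
Proof. by move=> ? ?; exact: is_deriveD. Qed.

Lemma derN f x a : has_der f x a -> has_der (fun y => - f y) x (- a).
Proof. by move=> ?; exact: is_deriveN. Qed.

Lemma derM f g x a b : has_der f x a -> has_der g x b ->
  has_der (fun y => f y * g y) x (f x * b + g x * a).
Proof. by move=> ? ?; exact: is_deriveM. Qed.

Lemma derX f n x a : has_der f x a ->
  has_der (fun y => f y ^+ n.+1) x (n.+1%:R * f x ^+ n * a).
Proof.
move=> fa; elim: n => [|n IH].
  by apply: (der_eq fa); rewrite expr0 mulr1 mul1r.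
under eq_fun do rewrite exprS.
by apply: (der_eq (derM fa IH)); rewrite /= -[n.+2%:R]natr1 !exprS; ring.
Qed.

Lemma derV f x a : f x != 0 -> has_der f x a ->
  has_der (fun y => (f y)^-1) x (- (f x) ^- 2 * a).
Proof. by move=> ? ?; exact: is_deriveV. Qed.

Lemma der_sin f x a : has_der f x a ->
  has_der (fun y => sin (f y)) x (cos (f x) * a).
Proof. by move=> ?; apply: is_derive1_comp. Qed.

Lemma der_cos f x a : has_der f x a ->
  has_der (fun y => cos (f y)) x (- sin (f x) * a).
Proof. by move=> ?; apply: is_derive1_comp. Qed.

Lemma der_atan f x a : has_der f x a ->
  has_der (fun y => atan (f y)) x ((1 + f x ^+ 2)^-1 * a).
Proof. by move=> ?; apply: is_derive1_comp. Qed.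

Lemma der_continuous f : (forall x, exists a, has_der f x a) -> continuous f.
Proof.
move=> fdf x; apply: differentiable_continuous; apply/derivable1_diffP.
by have [a []] := fdf x.
Qed.

(** The sign is asked only on the open interval because the closed form of [ssign'], which shows it
    nonnegative, excludes 0. *)
Lemma ge0_derive_le f df a b : a <= b ->
  (forall x, a <= x <= b -> has_der f x (df x)) ->
  (forall x, a < x < b -> 0 <= df x) -> f a <= f b.
Proof.
rewrite le_eqVlt => /predU1P[->//|ab] fdf df0.
have [x| |c] := @MVT R f df a b ab.
- by rewrite in_itv/= => /andP[/ltW ? /ltW ?]; apply: fdf; apply/andP.
- apply: derivable_within_continuous => x; rewrite in_itv/= => xab.
  by case: (fdf _ xab).
- rewrite in_itv/= => cab; rewrite -subr_ge0 => ->.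
  by rewrite mulr_ge0 ?df0// subr_ge0 ltW.
Qed.

End pointwise_derivatives.

Ltac derive :=
  repeat first [exact: der_cst | exact: der_id | apply: derD | apply: derN
    | apply: derX | apply: der_sin | apply: der_cos | apply: derM ].

(** * Taylor bounds for sine and cosine *)

Section trigonometric_bounds.
Context {R : realType}.
Implicit Types x : R.

Lemma sin_le x : 0 <= x -> sin x <= x.
Proof.
move=> x0; have := @ge0_derive_le R (fun y => y - sin y) (fun y => 1 - cos y) 0 x x0.
rewrite sin0 subr0 subr_ge0; apply => y _; last by rewrite subr_ge0 cos_le1.
by apply: der_eq; [derive|rewrite mulr1].
Qed.

Lemma cos_ge_quadratic x : 0 <= x -> 1 - x ^+ 2 / 2 <= cos x.
Proof.
move=> x0; have := @ge0_derive_le R (fun y => cos y - 1 + y ^+ 2 / 2)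
  (fun y => y - sin y) 0 x x0.
rewrite cos0 expr0n/= mul0r addr0 subrr => H.
suff: 0 <= cos x - 1 + x ^+ 2 / 2 by lra.
apply: H => y /andP[y0 _]; last by rewrite subr_ge0 sin_le// ltW.
apply: der_eq; [derive|rewrite /=; lra].
Qed.

Lemma sin_ge_quadratic x : 0 <= x -> x - x ^+ 2 / 2 <= sin x.
Proof.
move=> x0.
have cosl (y : R) : 0 <= y -> 1 - y <= cos y.
  move=> y0; have := @ge0_derive_le R (fun y => cos y - 1 + y)
    (fun y => 1 - sin y) 0 y y0.
  rewrite cos0 addr0 subrr => H; suff: 0 <= cos y - 1 + y by lra.
  apply: H => z _; last by rewrite subr_ge0 sin_le1.
  by apply: der_eq; [derive|rewrite /=; lra].
have := @ge0_derive_le R (fun y => sin y - y + y ^+ 2 / 2)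
  (fun y => cos y - 1 + y) 0 x x0.
rewrite sin0 expr0n/= mul0r addr0 subrr => H.
suff: 0 <= sin x - x + x ^+ 2 / 2 by lra.
apply: H => y /andP[y0 _]; last by have := cosl y (ltW y0); lra.
by apply: der_eq; [derive|rewrite /=; lra].
Qed.

Lemma cos_le_cubic x : 0 <= x -> cos x <= 1 - x ^+ 2 / 2 + x ^+ 3 / 6.
Proof.
move=> x0; have := @ge0_derive_le R (fun y => 1 - y ^+ 2 / 2 + y ^+ 3 / 6 - cos y)
  (fun y => sin y - y + y ^+ 2 / 2) 0 x x0.
rewrite cos0 !expr0n/= !mul0r subr0 addr0 subrr => H.
suff: 0 <= 1 - x ^+ 2 / 2 + x ^+ 3 / 6 - cos x by lra.
apply: H => y /andP[y0 _]; last by have := sin_ge_quadratic (ltW y0); lra.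
by apply: der_eq; [derive|rewrite /=; lra].
Qed.

Lemma sin_ge_cubic x : 0 <= x -> x - x ^+ 3 / 6 <= sin x.
Proof.
move=> x0; have := @ge0_derive_le R (fun y => sin y - y + y ^+ 3 / 6)
  (fun y => cos y - 1 + y ^+ 2 / 2) 0 x x0.
rewrite sin0 expr0n/= mul0r addr0 subrr => H.
suff: 0 <= sin x - x + x ^+ 3 / 6 by lra.
apply: H => y /andP[y0 _]; last by have := cos_ge_quadratic (ltW y0); lra.
by apply: der_eq; [derive|rewrite /=; lra].
Qed.

Lemma norm_sin_le x : `|sin x| <= `|x|.
Proof.
wlog x0 : x / 0 <= x => [hw|].
  have [/hw//|/ltW x0] := leP 0 x.
  by have := hw (- x); rewrite sinN !normrN oppr_ge0; apply.
have := sin_le x0; have := sin_ge_quadratic x0.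
have := sin_geN1 x; rewrite (ger0_norm x0) ler_norml => h1 h2 ->.
rewrite andbT; have [x1|x1] := leP x 1; last by lra.
have : 0 <= x * (1 - x) by rewrite mulr_ge0// subr_ge0.
by move: h2; rewrite expr2; lra.
Qed.

Lemma norm_sin_sub_le x : `|sin x - x| <= `|x| ^+ 3.
Proof.
wlog x0 : x / 0 <= x => [hw|].
  have [/hw//|/ltW x0] := leP 0 x.
  have := hw (- x); rewrite sinN opprK !normrN oppr_ge0 => /(_ x0).
  by rewrite [- sin x + x]addrC distrC.
have := sin_le x0; have := sin_ge_cubic x0; have : 0 <= x ^+ 3 by exact: exprn_ge0.
by rewrite (ger0_norm x0) ler_norml => h1 h2 h3; apply/andP; split; lra.
Qed.

Lemma cos_lower x : 1 - x ^+ 2 / 2 <= cos x.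
Proof.
have := cos_ge_quadratic (normr_ge0 x).
by rewrite cos_norm real_normK ?num_real.
Qed.

Lemma cos_upper x : cos x <= 1 - x ^+ 2 / 2 + `|x| ^+ 3.
Proof.
have := cos_le_cubic (normr_ge0 x); have := exprn_ge0 3 (normr_ge0 x).
by rewrite cos_norm real_normK ?num_real//; lra.
Qed.

End trigonometric_bounds.

(** * Integration over the frequency interval *)

Section unit_integrals.
Context {R : realType}.
Local Notation mu := (@lebesgue_measure R).
Implicit Types f g F : R -> R.

(** Open at 0, since the integrands below contain [t^-1]. *)
Definition unit_itv : set (measurableTypeR R) := `]0, 1]%classic.

Lemma measurable_unit_itv : measurable unit_itv.
Proof. exact: measurable_itv. Qed.
Local Hint Resolve measurable_unit_itv : core.

Lemma mu_unit_itv : mu unit_itv = 1%E.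
Proof. by rewrite /unit_itv lebesgue_measure_itv/= lte_fin ltr01 sube0. Qed.

Lemma unit_itvP t : unit_itv t -> 0 < t <= 1.
Proof. by rewrite /unit_itv/= in_itv. Qed.

Lemma bounded_unit_integrable f (M : R) : measurable_fun unit_itv f ->
  (forall t, unit_itv t -> `|f t| <= M) -> mu.-integrable unit_itv (EFin \o f).
Proof.
move=> mf fM; apply: measurable_bounded_integrable => //.
  by rewrite [X in (X < _)%E](_ : _ = 1%E) ?ltry//; exact: mu_unit_itv.
exists M; split; first exact: num_real.
by move=> N MN t /= /fM /le_trans; apply; exact: ltW.
Qed.

Lemma continuous_unit_integrable f : continuous f ->
  mu.-integrable unit_itv (EFin \o f).
Proof.
move=> cf; apply: (@integrableS _ _ _ mu `[0, 1]%classic) => //.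
  by move=> t /unit_itvP /andP[t0 t1]; rewrite /= in_itv/= (ltW t0).
apply: continuous_compact_integrable; first exact: segment_compact.
exact: continuous_subspaceT.
Qed.

Lemma unit_FTC f F : continuous f -> (forall t, has_der F t (f t)) ->
  \int[mu]_(t in unit_itv) f t = F 1 - F 0.
Proof.
move=> cf dF; rewrite /unit_itv Rintegral_itv_obnd_cbnd; last first.
  exact: continuous_unit_integrable.
have cF : continuous F by apply: der_continuous => t; exists (f t).
rewrite /Rintegral (@continuous_FTC2 _ f F 0 1)//.
- exact: continuous_subspaceT.
- split.
  + by move=> x _; case: (dF x).
  + by apply: cvg_at_right_filter; exact: cF.
  + by apply: cvg_at_left_filter; exact: cF.
- by move=> x _; rewrite derive1E; case: (dF x).
Qed.

Lemma measurable_inv_unit : measurable_fun unit_itv (fun t : R => t^-1).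
Proof.
have mV : measurable_fun (`]0, +oo[%classic : set R) (fun t : R => t^-1).
  apply: open_continuous_measurable_fun; first exact: interval_open.
  move=> t; rewrite inE/= in_itv/= andbT => t0.
  by apply: inv_continuous; rewrite gt_eqF.
have D : unit_itv `<=` (`]0, +oo[%classic : set R).
  by move=> t /unit_itvP /andP[t0 _]; rewrite /= in_itv/= t0.
have m0 : measurable (`]0, +oo[%classic : set R) by exact: measurable_itv.
exact: (measurable_funS m0 D mV).
Qed.

Lemma unit_Rintegral_cst (c : R) : \int[mu]_(t in unit_itv) (fun=> c) t = c.
Proof.
rewrite Rintegral_cst// [X in fine X](_ : _ = 1%E) ?mulr1//.
exact: mu_unit_itv.
Qed.

Lemma unit_Rintegral_ge0 f : (forall t, unit_itv t -> 0 <= f t) ->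
  0 <= \int[mu]_(t in unit_itv) f t.
Proof. by move=> f0; apply: Rintegral_ge0. Qed.

End unit_integrals.
#[global] Hint Resolve measurable_unit_itv : core.

(** * A band-limited smoothing of the sign *)

Section smoothed_sign.
Context {R : realType}.
Local Notation mu := (@lebesgue_measure R).
Implicit Types x y t : R.

(* The self-convolution of a parabolic bump, whose cosine transform is
   therefore a square. *)
Definition taper t : R := 1 - 5 * t ^+ 2 + 5 * t ^+ 3 - t ^+ 5.

Lemma taperE t : taper t = (1 - t) ^+ 3 * (1 + 3 * t + t ^+ 2).
Proof. by rewrite /taper; ring. Qed.

Lemma taper_ge0 t : 0 <= t <= 1 -> 0 <= taper t.
Proof.
move=> /andP[t0 t1]; rewrite taperE mulr_ge0//; first by rewrite exprn_ge0// subr_ge0.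
by rewrite !addr_ge0 ?mulr_ge0 ?sqr_ge0.
Qed.

Lemma taper_le1 t : 0 <= t <= 1 -> taper t <= 1.
Proof.
move=> /andP[t0 t1]; have : 0 <= 5 * t ^+ 2 * (1 - t) + t ^+ 5.
  by rewrite addr_ge0 ?mulr_ge0 ?sqr_ge0 ?exprn_ge0 ?subr_ge0.
by rewrite /taper; lra.
Qed.

Lemma norm_taper_le1 t : unit_itv t -> `|taper t| <= 1.
Proof.
move=> /unit_itvP /andP[/ltW t0 t1].
by rewrite ger0_norm ?taper_le1 ?taper_ge0 ?t0.
Qed.

(** A truncated Dirichlet integral: with [taper] replaced by 1 and the interval by the half-line,
    the value would be [pi / 2] times the sign of [x]. *)
Definition ssign x : R := \int[mu]_(t in unit_itv) (taper t * (sin (t * x) / t)).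

Definition ssign' x : R := \int[mu]_(t in unit_itv) (taper t * cos (t * x)).

Lemma continuous_taper : continuous taper.
Proof. by apply: der_continuous => t; eexists; rewrite /taper; derive. Qed.

Lemma measurable_ssign_integrand x :
  measurable_fun unit_itv (fun t => taper t * (sin (t * x) / t)).
Proof.
apply: measurable_funM.
  apply: measurable_funTS; apply: continuous_measurable_fun.
  exact: continuous_taper.
apply: measurable_funM; last exact: measurable_inv_unit.
apply: measurable_funTS; apply: continuous_measurable_fun.
by apply: der_continuous => t; eexists; derive.
Qed.

Lemma norm_ssign_integrand x t : unit_itv t ->
  `|taper t * (sin (t * x) / t)| <= `|x|.
Proof.
move=> It; have /andP[t0 t1] := unit_itvP It.
rewrite normrM -[leRHS]mul1r ler_pM ?norm_taper_le1//.
rewrite normf_div ler_pdivrMr ?normr_gt0 ?gt_eqF//.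
by rewrite (le_trans (norm_sin_le _))// normrM mulrC.
Qed.

Lemma integrable_ssign x :
  mu.-integrable unit_itv (EFin \o (fun t => taper t * (sin (t * x) / t))).
Proof.
apply: (bounded_unit_integrable (M := `|x|)).
  exact: measurable_ssign_integrand.
by move=> t; exact: norm_ssign_integrand.
Qed.

(** Differentiating in [x] cancels the factor [t^-1], and the resulting integrand is dominated by 1
    uniformly in [x]. *)
Lemma der_ssign x : has_der ssign x (ssign' x).
Proof.
pose f y t := taper t * (sin (t * y) / t).
have df y t : has_der (f ^~ t) y (taper t * (cos (t * y) * t / t)).
  by apply: der_eq; [rewrite /f; derive|rewrite /=; ring].
have dfE y t : unit_itv t -> partial1of2 f y t = taper t * cos (t * y).
  move=> /unit_itvP /andP[t0 _]; rewrite partial1of2E.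
  by have [_ ->] := df y t; rewrite mulfK// gt_eqF.
have Ix : (`]x - 1, x + 1[%classic : set R) x.
  by rewrite /= in_itv/=; apply/andP; split; lra.
have intf y : (`]x - 1, x + 1[%classic : set R) y ->
    mu.-integrable unit_itv (EFin \o f y) by move=> _; exact: integrable_ssign.
have derf y t : (`]x - 1, x + 1[%classic : set R) y -> unit_itv t ->
    derivable (f ^~ t) y 1 by move=> _ _; case: (df y t).
have int1 : mu.-integrable unit_itv (EFin \o (fun=> 1%R)).
  exact: continuous_unit_integrable (@cst_continuous _ _ _).
have ub y t : (`]x - 1, x + 1[%classic : set R) y -> unit_itv t ->
    `|partial1of2 f y t| <= 1.
  move=> _ It; rewrite dfE// normrM -[leRHS]mul1r ler_pM//.
    exact: norm_taper_le1.
  exact: cos_max.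
constructor.
  exact: (derivable_under_integral measurable_unit_itv Ix intf derf (fun _ => ler01) int1 ub).
have := differentiation_under_integral measurable_unit_itv Ix intf derf (fun _ => ler01) int1 ub.
rewrite derive1E => ->; apply: eq_Rintegral => t /set_mem It.
exact: dfE.
Qed.

Lemma ssign'E x : x != 0 ->
  ssign' x = 60 * ((x * cos (x / 2) - 2 * sin (x / 2)) / x ^+ 3) ^+ 2.
Proof.
move=> x0.
(* Iterated integration by parts: the coefficients are the successive derivatives of [taper], up to
   the fifth, which is the constant -120. *)
pose F t := taper t * sin (t * x) / x
  + (- 10 * t + 15 * t ^+ 2 - 5 * t ^+ 4) * cos (t * x) / x ^+ 2
  - (- 10 + 30 * t - 20 * t ^+ 3) * sin (t * x) / x ^+ 3
  - (30 - 60 * t ^+ 2) * cos (t * x) / x ^+ 4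
  + (- 120 * t) * sin (t * x) / x ^+ 5
  - 120 * cos (t * x) / x ^+ 6.
rewrite /ssign' (@unit_FTC R _ F).
- have c2 := cos2Dsin2 (x / 2).
  (* In half angles the value differs from a perfect square only by a multiple of
     [1 - (cos ^+ 2 + sin ^+ 2)]. *)
  have hx : x = (x / 2) *+ 2 by rewrite mulr2n; lra.
  rewrite /F /taper !mul0r !mul1r sin0 cos0 [in cos x]hx [in sin x]hx.
  rewrite cos_mulr2n sin_mulr2n.
  transitivity (60 * ((x * cos (x / 2) - 2 * sin (x / 2)) / x ^+ 3) ^+ 2
      + 240 * (1 - (cos (x / 2) ^+ 2 + sin (x / 2) ^+ 2)) / x ^+ 6).
    by move: (cos (x / 2)) (sin (x / 2)) => c s; field.
  by rewrite c2 subrr mulr0 mul0r addr0.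
- by apply: der_continuous => t; eexists; rewrite /taper; derive.
- move=> t; apply: der_eq; first by rewrite /F /taper; derive.
  by rewrite /taper /=; field.
Qed.

Lemma ssign'_ge0 x : x != 0 -> 0 <= ssign' x.
Proof. by move=> x0; rewrite ssign'E// mulr_ge0// sqr_ge0. Qed.

(** Cubic decay is the right strength: integrated, it gives a tail of order [x ^- 2], the same order
    as the lower bound of [envelope]. *)
Lemma ssign'_le x : 1 <= x -> ssign' x <= 540 / x ^+ 3.
Proof.
move=> x1; have x0 : 0 < x by lra.
rewrite ssign'E ?gt_eqF// expr_div_n.
set u := (_ - _).
(* [|u| <= 3 * x] gives [9 * x ^+ 2], and [1 <= x] raises the exponent. *)
have B : u ^+ 2 <= 9 * x ^+ 3.
  have c1 : x * cos (x / 2) <= x by rewrite ler_piMr ?cos_le1// ltW.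
  have c2 : - x <= x * cos (x / 2).
    by rewrite -mulrN1 ler_wpM2l ?cos_geN1// ltW.
  have u1 : u <= 3 * x by have := sin_geN1 (x / 2); rewrite /u; lra.
  have u2 : - (3 * x) <= u by have := sin_le1 (x / 2); rewrite /u; lra.
  have : 0 <= (3 * x - u) * (3 * x + u) by rewrite mulr_ge0; lra.
  have : 0 <= x ^+ 2 * (x - 1) by rewrite mulr_ge0 ?sqr_ge0//; lra.
  by lra.
have x3 : 0 < x ^+ 3 by rewrite exprn_gt0.
rewrite ler_pdivlMr// (_ : _ * _ = 60 * (u ^+ 2 / x ^+ 3)); last first.
  by field; rewrite gt_eqF.
by rewrite (_ : 540 = 60 * 9 :> R) ?ler_pM2l ?ler_pdivrMr//; lra.
Qed.

Lemma ssign_homo x y : 0 <= x -> x <= y -> ssign x <= ssign y.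
Proof.
move=> x0 xy; apply: (ge0_derive_le (df := ssign')) => // z.
  by move=> _; exact: der_ssign.
by move=> /andP[xz _]; apply: ssign'_ge0; rewrite gt_eqF// (le_lt_trans x0).
Qed.

Lemma ssign0 : ssign 0 = 0.
Proof.
rewrite /ssign; under eq_Rintegral do rewrite mulr0 sin0 mul0r mulr0.
by rewrite Rintegral_cst// mul0r.
Qed.

Lemma ssignN x : ssign (- x) = - ssign x.
Proof.
rewrite -[RHS]mulN1r -RintegralZl//; last exact: integrable_ssign.
by apply: eq_Rintegral => t _; rewrite mulrN sinN mulNr mulrN mulN1r.
Qed.

Lemma ssign1_le1 : ssign 1 <= 1.
Proof.
rewrite -[leRHS](unit_Rintegral_cst 1).
apply: le_Rintegral => //; first exact: integrable_ssign.
  exact: continuous_unit_integrable (@cst_continuous _ _ _).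
move=> t It; have := norm_ssign_integrand 1 It.
by rewrite normr1; exact: le_trans (ler_norm _).
Qed.

Lemma ssign_tail x y : 1 <= x -> x <= y -> ssign y - ssign x <= 270 / x ^+ 2.
Proof.
move=> x1 xy.
have key := @ge0_derive_le R (fun z => - (ssign z) - 270 * (z ^+ 2)^-1)
  (fun z => - (ssign' z) + 540 / z ^+ 3) x y xy.
have yx0 : 0 <= 270 / y ^+ 2 by rewrite divr_ge0 ?sqr_ge0.
suff H : - ssign x - 270 / x ^+ 2 <= - ssign y - 270 / y ^+ 2 by lra.
apply: key.
- move=> z /andP[xz _]; have z0 : z != 0 by rewrite gt_eqF//; lra.
  apply: der_eq.
    apply: derD; first by apply: derN; exact: der_ssign.
    apply: derN; apply: derM; first exact: der_cst.
    by apply: derV; [rewrite sqrf_eq0|derive].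
  by rewrite /=; field.
- move=> z /andP[xz _]; rewrite addrC subr_ge0 ssign'_le//; lra.
Qed.

(** By monotonicity on the half-line this is the limit of [ssign] at infinity, the height [c] of the
    step that is minorized. *)
Definition ssign_lim : R := sup [set ssign x | x in [set x | 0 <= x]].

(** 271 is the bound 1 at [x = 1] plus the whole tail 270 beyond it. *)
Let ssign_ub x : 0 <= x -> ssign x <= 271.
Proof.
move=> x0; have [x1|/ltW x1] := leP x 1.
  by have := ssign_homo x0 x1; have := ssign1_le1; lra.
by have := ssign_tail (lexx 1) x1; have := ssign1_le1; rewrite expr1n; lra.
Qed.

Let has_sup_ssign : has_sup [set ssign x | x in [set x | 0 <= x]].
Proof.
split; first by exists (ssign 0), 0 => //=.
by exists 271 => _ [x x0 <-]; exact: ssign_ub.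
Qed.

Lemma ssign_le_lim x : 0 <= x -> ssign x <= ssign_lim.
Proof. by move=> x0; apply: sup_upper_bound => //; exists x. Qed.

Lemma ssign_lim_ge0 : 0 <= ssign_lim.
Proof. by rewrite -ssign0; exact: ssign_le_lim. Qed.

(** The deficit is put into the shape of the lower bound of [envelope]. Up to 1 it is at most 271
    while [x + pi <= 1 + pi]; beyond 1 it is at most [270 / x ^+ 2] while [x + pi <= x * (1 + pi)].
    The constant 300 covers both. *)
Lemma ssign_lim_sub_le x : 0 <= x ->
  ssign_lim - ssign x <= 300 * (1 + pi) ^+ 2 / (x + pi) ^+ 2.
Proof.
move=> x0; have p0 := pi_gt0 R.
have xp : 0 < (x + pi) ^+ 2 by rewrite exprn_gt0//; lra.
rewrite ler_pdivlMr//.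
have [x1|x1] := leP x 1.
  have h1 : ssign_lim - ssign x <= 271.
    have := ssign_homo (lexx 0) x0; rewrite ssign0.
    suff : ssign_lim <= 271 by lra.
    by apply: ge_sup; [exists (ssign 0), 0 => //=|move=> _ [y y0 <-]; exact: ssign_ub].
  have h2 : (x + pi) ^+ 2 <= (1 + pi) ^+ 2 by rewrite lerXn2r ?nnegrE; lra.
  apply: (@le_trans _ _ (271 * (x + pi) ^+ 2)).
    by rewrite ler_wpM2r// ltW.
  by apply: ler_pM => //; [exact: ltW|lra].
have h1 : ssign_lim - ssign x <= 270 / x ^+ 2.
  suff : ssign_lim <= ssign x + 270 / x ^+ 2 by lra.
  apply: ge_sup; first by exists (ssign 0), 0 => //=.
  have q0 : 0 <= 270 / x ^+ 2 by rewrite divr_ge0 ?sqr_ge0.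
  move=> _ [y y0 <-]; have [xy|/ltW yx] := leP x y.
    by have := ssign_tail (ltW x1) xy; lra.
  by have := ssign_homo y0 yx; lra.
have h2 : (x + pi) ^+ 2 <= x ^+ 2 * (1 + pi) ^+ 2.
  have xpi : pi <= x * pi by rewrite ler_peMl ?pi_ge0// ltW.
  rewrite -exprMn; apply: lerXn2r; rewrite ?nnegrE.
  - by lra.
  - by rewrite mulrDr mulr1; lra.
  - by rewrite mulrDr mulr1; lra.
apply: (@le_trans _ _ (270 / x ^+ 2 * (x ^+ 2 * (1 + pi) ^+ 2))).
  apply: ler_pM => //; last exact: ltW.
  by rewrite subr_ge0 ssign_le_lim.
rewrite mulrA divfK ?sqrf_eq0 ?gt_eqF//; last lra.
by rewrite ler_wpM2r ?sqr_ge0//; lra.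
Qed.

End smoothed_sign.

(** * Correction of the smoothed sign to a minorant *)

Section band_limited_minorant.
Context {R : realType}.
Local Notation mu := (@lebesgue_measure R).
Implicit Types x y t : R.

(** The Fejer kernel [(1 - cos x) / x ^+ 2], in integral form so that the band limit is visible and
    0 is no exception. *)
Definition fejer x : R := \int[mu]_(t in unit_itv) ((1 - t) * cos (t * x)).

Let integrable_fejer x :
  mu.-integrable unit_itv (EFin \o (fun t => (1 - t) * cos (t * x))).
Proof.
apply: continuous_unit_integrable.
by apply: der_continuous => t; eexists; derive.
Qed.

Lemma fejerM x : fejer x * x ^+ 2 = 1 - cos x.
Proof.
have [->|x0] := eqVneq x 0; first by rewrite expr0n mulr0 cos0 subrr.
rewrite /fejer (@unit_FTC R _
  (fun t => (1 - t) * sin (t * x) / x - cos (t * x) / x ^+ 2)).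
- by rewrite !mul0r !mul1r sin0 cos0; field.
- by apply: der_continuous => t; eexists; derive.
- by move=> t; apply: der_eq; [derive|rewrite /=; field].
Qed.

Lemma fejer_ge0 x : 0 <= fejer x.
Proof.
have [->|x0] := eqVneq x 0.
  apply: unit_Rintegral_ge0 => t /unit_itvP /andP[t0 t1].
  by rewrite mulr0 cos0 mulr1 subr_ge0.
have x2 : 0 < x ^+ 2 by rewrite exprn_even_gt0.
by rewrite -(pmulr_lge0 _ x2) fejerM subr_ge0 cos_le1.
Qed.

(** The correction must dominate the deficit of [ssign] everywhere while keeping the band limit; a
    single Fejer kernel vanishes at the nonzero multiples of [2 * pi]. *)
Definition envelope x : R :=
  \int[mu]_(t in unit_itv) ((1 - t) * (1 + cos (pi * t)) * cos (t * x)).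

Let integrable_envelope x : mu.-integrable unit_itv
  (EFin \o (fun t => (1 - t) * (1 + cos (pi * t)) * cos (t * x))).
Proof.
apply: continuous_unit_integrable.
by apply: der_continuous => t; eexists; derive.
Qed.

(* The shifts by pi fill in the zeros of the Fejer kernel. *)
Lemma envelopeE x :
  envelope x = fejer x + 2^-1 * (fejer (x + pi) + fejer (x - pi)).
Proof.
rewrite /fejer -RintegralD// -RintegralZl//; last first.
  apply: continuous_unit_integrable.
  by apply: der_continuous => t; eexists; derive.
rewrite -RintegralD//; last first.
  apply: continuous_unit_integrable.
  by apply: der_continuous => t; eexists; derive.
apply: eq_Rintegral => t _.
by rewrite [t * (x + pi)]mulrDr [t * (x - pi)]mulrBr cosD cosB [pi * t]mulrC; field.
Qed.

(** A Fejer kernel at [y] times [q] is at least [1 - cos y] as soon as [y ^+ 2 <= q]. A shift by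
    [pi] flips the sign of the cosine, so in the weighted sum the cosines cancel and 2 remains. *)
Lemma envelope_ge x : (`|x| + pi) ^- 2 <= envelope x.
Proof.
have p0 := pi_gt0 R; have ax := normr_ge0 x.
set q := (`|x| + pi) ^+ 2.
have q0 : 0 < q by rewrite exprn_gt0//; lra.
have le_fejer y : `|y| <= `|x| + pi -> 1 - cos y <= fejer y * q.
  move=> yx; rewrite -fejerM ler_wpM2l ?fejer_ge0//.
  by rewrite -real_normK ?num_real// lerXn2r ?nnegrE//; lra.
rewrite -[q^-1]mul1r ler_pdivrMr// envelopeE.
have := le_fejer x; rewrite lerDl (ltW p0) => /(_ isT).
have := le_fejer (x + pi); rewrite cosDpi.
rewrite (le_trans (ler_normD _ _)) ?(gtr0_norm p0)// => /(_ isT).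
have cosBpi : cos (x - pi) = - cos x.
  by rewrite -[in RHS](subrK pi x) cosDpi opprK.
have := le_fejer (x - pi); rewrite cosBpi.
rewrite (le_trans (ler_normB _ _)) ?(gtr0_norm p0)// => /(_ isT).
by lra.
Qed.

Definition minorant_coef : R := 300 * (1 + pi) ^+ 2.

Definition minorant x : R := ssign x - minorant_coef * envelope x.

Let coef_ge0 : 0 <= minorant_coef.
Proof. by rewrite mulr_ge0 ?sqr_ge0. Qed.

Lemma minorant_le x : 0 < x -> minorant x <= ssign_lim.
Proof.
move=> x0; have := ssign_le_lim (ltW x0).
have : 0 <= minorant_coef * envelope x.
  by rewrite mulr_ge0// (le_trans _ (envelope_ge x))// invr_ge0 sqr_ge0.
by rewrite /minorant; lra.
Qed.

(** By oddness [ssign] overshoots [- ssign_lim] exactly by the deficit at [- x], which the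
    subtracted envelope absorbs. Zero belongs to this side, so the closed event [Z <= 0] will be
    covered. *)
Lemma minorant_leN x : x <= 0 -> minorant x <= - ssign_lim.
Proof.
move=> x0; have Nx0 : 0 <= - x by rewrite oppr_ge0.
have := ssign_lim_sub_le Nx0; rewrite ssignN.
have : minorant_coef / (- x + pi) ^+ 2 <= minorant_coef * envelope x.
  by rewrite ler_wpM2l// -(ler0_norm x0) envelope_ge.
by rewrite /minorant /minorant_coef; lra.
Qed.

Definition minorant_integrand x t : R :=
  taper t * (sin (t * x) / t)
  - minorant_coef * ((1 - t) * (1 + cos (pi * t)) * cos (t * x)).

Let integrable_scaled_envelope x : mu.-integrable unit_itv (EFin \o (fun t =>
  minorant_coef * ((1 - t) * (1 + cos (pi * t)) * cos (t * x)))).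
Proof.
apply: continuous_unit_integrable.
by apply: der_continuous => t; eexists; derive.
Qed.

Lemma integrable_minorant_integrand x :
  mu.-integrable unit_itv (EFin \o minorant_integrand x).
Proof.
exact: integrableB (integrable_ssign x) (integrable_scaled_envelope x).
Qed.

Lemma minorantE x :
  minorant x = \int[mu]_(t in unit_itv) minorant_integrand x t.
Proof.
rewrite /minorant /ssign /envelope -RintegralZl// -RintegralB//.
exact: integrable_ssign.
Qed.

End band_limited_minorant.

(** * Real and imaginary parts of characteristic functions *)

Definition cos_mean d (T : measurableType d) (R : realType)
    (P : probability T R) (Z : T -> R) (t : R) : R := \int[P]_w cos (t * Z w).

Definition sin_mean d (T : measurableType d) (R : realType)
    (P : probability T R) (Z : T -> R) (t : R) : R := \int[P]_w sin (t * Z w).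

Section bounded_expectations.
Context d (T : measurableType d) (R : realType) (P : probability T R).

Lemma bounded_integrable (X : T -> R) (M : R) : measurable_fun setT X ->
  (forall w, `|X w| <= M) -> P.-integrable setT (EFin \o X).
Proof.
move=> mX XM; apply: measurable_bounded_integrable => //.
  by rewrite [X in (X < _)%E](_ : _ = 1%E) ?ltry//; exact: probability_setT.
exists M; split; first exact: num_real.
by move=> N MN w _ /=; exact: le_trans (XM _) (ltW MN).
Qed.

Lemma measurable_cosM (Z : T -> R) t : measurable_fun setT Z ->
  measurable_fun setT (fun w => cos (t * Z w)).
Proof.
move=> mZ; apply: (@measurableT_comp _ _ _ _ _ _ (@cos R)).
  by apply: continuous_measurable_fun; exact: continuous_cos.
exact: measurable_funM.
Qed.

Lemma measurable_sinM (Z : T -> R) t : measurable_fun setT Z ->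
  measurable_fun setT (fun w => sin (t * Z w)).
Proof.
move=> mZ; apply: (@measurableT_comp _ _ _ _ _ _ (@sin R)).
  by apply: continuous_measurable_fun; exact: continuous_sin.
exact: measurable_funM.
Qed.

Lemma integrable_cosM (Z : T -> R) t : measurable_fun setT Z ->
  P.-integrable setT (EFin \o (fun w => cos (t * Z w))).
Proof.
move=> mZ; apply: (bounded_integrable (M := 1)) => [|w]; last exact: cos_max.
exact: measurable_cosM.
Qed.

Lemma integrable_sinM (Z : T -> R) t : measurable_fun setT Z ->
  P.-integrable setT (EFin \o (fun w => sin (t * Z w))).
Proof.
move=> mZ; apply: (bounded_integrable (M := 1)) => [|w]; last exact: sin_max.
exact: measurable_sinM.
Qed.

End bounded_expectations.

(** * The expected minorant as a frequency integral *)

Section expected_minorant.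
Context d (T : measurableType d) (R : realType) (P : probability T R).
Local Notation mu := (@lebesgue_measure R).
Variable Z : T -> R.
Hypothesis mZ : measurable_fun setT Z.
Hypothesis iZ : P.-integrable setT (EFin \o Z).

Local Notation C := (@minorant_coef R).
Local Notation cosZ := (cos_mean P Z).
Local Notation sinZ := (sin_mean P Z).

Let C_ge0 : 0 <= C. Proof. by rewrite mulr_ge0 ?sqr_ge0. Qed.

(** Near [t = 0] the sine term is of size [|x|], so Fubini rests on the integrability of [Z]. *)
Let integrand_le x (t : R) : unit_itv t ->
  `|minorant_integrand x t| <= `|x| + 2 * C.
Proof.
move=> It; have /andP[t0 t1] := unit_itvP It.
rewrite (le_trans (ler_normB _ _))// lerD ?norm_ssign_integrand//.
rewrite normrM (ger0_norm C_ge0) mulrC ler_wpM2r// !normrM.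
have h1 : `|1 - t| <= 1 by rewrite ler_norml; lra.
have h2 : `|1 + cos (pi * t)| <= 2.
  by have := cos_le1 (pi * t); have := cos_geN1 (pi * t); rewrite ler_norml; lra.
rewrite -[leRHS]mulr1 ler_pM// ?cos_max//.
by rewrite -[leRHS]mul1r ler_pM.
Qed.

Let f (z : T * measurableTypeR R) : \bar R :=
  (minorant_integrand (Z z.1) z.2 * \1_(@unit_itv R) z.2)%:E.

Let mf : measurable_fun setT f.
Proof.
have m2 : measurable_fun setT (fun z : T * measurableTypeR R => (z.2 : R)).
  exact: measurable_snd.
have mc (g : R -> R) : continuous g ->
    measurable_fun setT (fun z : T * measurableTypeR R => g z.2).
  move=> cg; apply: (@measurableT_comp _ _ _ _ _ _ g) => //.
  exact: continuous_measurable_fun.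
have mZ1 : measurable_fun setT (fun z : T * measurableTypeR R => Z z.1).
  by apply: measurableT_comp => //; exact: measurable_fst.
have mtZ : measurable_fun setT (fun z : T * measurableTypeR R => z.2 * Z z.1).
  exact: measurable_funM.
have m1 : measurable_fun setT
    (fun z : T * measurableTypeR R => \1_(@unit_itv R) z.2 : R).
  by apply: measurableT_comp => //; exact: measurable_indic.
have mV : measurable_fun setT (fun z : T * measurableTypeR R =>
    ((fun t : R => t^-1) \_ unit_itv) z.2 : R).
  apply: (@measurableT_comp _ _ _ _ _ _ ((fun t : R => t^-1) \_ (@unit_itv R))) => //.
  apply/(measurable_restrictT _ (@measurable_unit_itv R)).
  exact: measurable_inv_unit.
apply/measurable_EFinP.
(* The indicator is moved onto the inverse, whose measurability is available on the unit
   interval. *)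
rewrite (_ : (fun z => _) = (fun z : T * measurableTypeR R =>
   taper z.2 * (sin (z.2 * Z z.1) * ((fun t : R => t^-1) \_ unit_itv) z.2)
   - C * ((1 - z.2) * (1 + cos (pi * z.2)) * cos (z.2 * Z z.1))
     * \1_unit_itv z.2)); last first.
  apply/funext => -[w t]; rewrite /minorant_integrand /patch indicE /=.
  by case: ifP => _; rewrite ?mulr1// !mulr0 subr0.
have msin : measurable_fun setT (fun z : T * measurableTypeR R => sin (z.2 * Z z.1)).
  apply: (@measurableT_comp _ _ _ _ _ _ (@sin R)) => //.
  by apply: continuous_measurable_fun; exact: continuous_sin.
have mcos : measurable_fun setT (fun z : T * measurableTypeR R => cos (z.2 * Z z.1)).
  apply: (@measurableT_comp _ _ _ _ _ _ (@cos R)) => //.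
  by apply: continuous_measurable_fun; exact: continuous_cos.
apply: measurable_funB.
  apply: measurable_funM; first by apply: mc; exact: continuous_taper.
  exact: measurable_funM.
apply: measurable_funM => //; apply: measurable_funM => //.
apply: measurable_funM => //.
by apply: (mc (fun t => (1 - t) * (1 + cos (pi * t)))); apply: der_continuous => t; eexists; derive.
Qed.

Let integrable_f : (P \x mu)%E.-integrable setT f.
Proof.
have C0 : 0 <= 2 * C by rewrite mulr_ge0 ?C_ge0.
pose g (z : T * measurableTypeR R) : \bar R :=
  ((`|Z z.1| + 2 * C) * \1_(@unit_itv R) z.2)%:E.
have ig : (P \x mu)%E.-integrable setT g.
  have mg : measurable_fun setT g.
    apply/measurable_EFinP; apply: measurable_funM; last first.
      by apply: measurableT_comp => //; exact: measurable_indic.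
    apply: measurable_funD => //; apply: measurableT_comp => //.
    by apply: measurableT_comp => //; exact: measurable_fst.
  have g0 w (t : R) : 0 <= (`|Z w| + 2 * C) * \1_(@unit_itv R) t.
    apply: mulr_ge0; last by rewrite indicE ler0n.
    exact: addr_ge0.
  apply/integrable12ltyP => //.
  under eq_integral => w _.
    under eq_integral => t _.
      rewrite /g/= ger0_norm ?g0// EFinM; over.
    rewrite ge0_integralZl//; last 2 first.
      by apply/measurable_EFinP; exact: measurable_indic.
      by rewrite lee_fin addr_ge0.
    rewrite integral_indic// setIT [X in (_ * X)%E](_ : _ = 1%E); last first.
      exact: mu_unit_itv.
    rewrite mule1; over.
  rewrite /=; under eq_integral do rewrite EFinD.
  rewrite ge0_integralD//; last first.
    by apply/measurable_EFinP; apply: measurableT_comp.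
  rewrite lte_add_pinfty//; first by case/integrableP : iZ.
  rewrite (eq_integral (cst (2 * C)%:E))// integral_cst//.
  by rewrite [X in (_ * X)%E](_ : _ = 1%E) ?mule1 ?ltry//; exact: probability_setT.
apply: (le_integrable _ _ _ ig) => // -[w t] _.
rewrite /f /g/= lee_fin !normrM indicE; case: (boolP (t \in unit_itv)) => tD.
  rewrite normr1 !mulr1 (ger0_norm (addr_ge0 (normr_ge0 _) C0)).
  by apply: integrand_le; exact: set_mem.
by rewrite normr0 !mulr0.
Qed.

Let fE1 w : (\int[mu]_t f (w, t) = (minorant (Z w))%:E)%E.
Proof.
rewrite minorantE /Rintegral fineK; last first.
  apply: integrable_fin_num => //.
  exact: integrable_minorant_integrand.
rewrite [RHS]integral_mkcond; apply: eq_integral => t _.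
rewrite /f /patch/= indicE; case: ifP => _; first by rewrite mulr1.
by rewrite mulr0.
Qed.

Let fE2 t : unit_itv t -> (\int[P]_w f (w, t) =
  (taper t / t * sinZ t - C * ((1 - t) * (1 + cos (pi * t))) * cosZ t)%:E)%E.
Proof.
move=> It.
have iS := integrable_sinM P t mZ.
have iC := integrable_cosM P t mZ.
have iS' := integrableZl measurableT (taper t / t) iS.
have iC' := integrableZl measurableT (C * ((1 - t) * (1 + cos (pi * t)))) iC.
rewrite /sin_mean /cos_mean -!RintegralZl// -RintegralB//.
rewrite /Rintegral fineK; last first.
  by apply: integrable_fin_num => //; exact: integrableB iS' iC'.
apply: eq_integral => w _; rewrite /f/= indicE mem_set// mulr1.
by congr (_%:E); rewrite /minorant_integrand; move: minorant_coef => c /=; ring.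
Qed.

Lemma integrable_minorant : P.-integrable setT (EFin \o (minorant \o Z)).
Proof.
apply: eq_integrable (integrable_fubini_F integrable_f) => //.
by move=> w _; exact: fE1.
Qed.

Lemma expected_minorantE : \int[P]_w minorant (Z w) =
  \int[mu]_(t in unit_itv)
    (taper t / t * sinZ t - C * ((1 - t) * (1 + cos (pi * t))) * cosZ t).
Proof.
rewrite /Rintegral; congr fine.
under eq_integral do rewrite -fE1.
rewrite (Fubini integrable_f) [RHS]integral_mkcond.
apply: eq_integral => t _; rewrite /patch; case: ifP => tD.
  by rewrite fE2//; exact: set_mem.
by under eq_integral do rewrite /f/= indicE tD mulr0; rewrite integral0.
Qed.

Lemma integrable_expected_minorant : mu.-integrable unit_itv (EFin \o (fun t =>
  taper t / t * sinZ t - C * ((1 - t) * (1 + cos (pi * t))) * cosZ t)).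
Proof.
have ig : mu.-integrable setT (fun t => \int[P]_w f (w, t))%E.
  pose f' (z : measurableTypeR R * T) := f (z.2, z.1).
  have mf' : measurable_fun setT f'.
    apply: measurableT_comp => //; apply/measurable_fun_pairP; split => /=.
      exact: measurable_snd.
    exact: measurable_fst.
  have if' : (mu \x P)%E.-integrable setT f'.
    by apply/integrable21ltyP => //; apply/integrable12ltyP.
  exact: (integrable_fubini_F if').
apply: eq_integrable (integrableS _ _ _ ig) => //.
by move=> t /set_mem It; exact: fE2.
Qed.

End expected_minorant.

(** * Powers of a complex number in coordinates *)

Section complex_powers.
Context {R : realType}.
Variables r s : R.

(* Real and imaginary parts of (r + i s) ^ n. *)
Fixpoint cpow n : R * R :=
  if n is n'.+1 then
    let z := cpow n' in (z.1 * r - z.2 * s, z.1 * s + z.2 * r)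
  else (1, 0).

Lemma cpow1S n : (cpow n.+1).1 = (cpow n).1 * r - (cpow n).2 * s.
Proof. by []. Qed.

Lemma cpow2S n : (cpow n.+1).2 = (cpow n).1 * s + (cpow n).2 * r.
Proof. by []. Qed.

Variable rho : R.
Hypothesis rho_ge0 : 0 <= rho.
Hypothesis rhoE : rho ^+ 2 = r ^+ 2 + s ^+ 2.

Let norm_le (x y : R) : 0 <= y -> x ^+ 2 <= y ^+ 2 -> `|x| <= y.
Proof. by move=> y0; rewrite -(real_normK (num_real x)) ler_pXn2r ?nnegrE//. Qed.

Let r_le : `|r| <= rho.
Proof. by apply: norm_le => //; rewrite rhoE lerDl sqr_ge0. Qed.

Lemma cpow_norm n : (cpow n).1 ^+ 2 + (cpow n).2 ^+ 2 = (rho ^+ n) ^+ 2.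
Proof.
elim: n => [|n IH] /=; first by rewrite !expr0 expr1n expr0n addr0.
by rewrite [rho ^+ n.+1]exprS exprMn -IH rhoE; ring.
Qed.

Lemma cpow1_le n : `|(cpow n).1| <= rho ^+ n.
Proof. by apply: norm_le; rewrite ?exprn_ge0// -cpow_norm lerDl sqr_ge0. Qed.

Lemma cpow2_le n : `|(cpow n).2| <= rho ^+ n.
Proof. by apply: norm_le; rewrite ?exprn_ge0// -cpow_norm lerDr sqr_ge0. Qed.

(** Each of the [n.+1] factors may supply the imaginary part [s]; the other [n] are bounded by the
    modulus [rho]. *)
Lemma cpow2_small n : `|(cpow n.+1).2| <= n.+1%:R * rho ^+ n * `|s|.
Proof.
elim: n => [|n IH].
  by rewrite /= mul1r mul0r addr0 expr0 !mul1r.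
rewrite cpow2S; apply: (le_trans (ler_normD _ _)); rewrite !normrM.
apply: (@le_trans _ _ (rho ^+ n.+1 * `|s| + n.+1%:R * rho ^+ n * `|s| * rho)).
  by apply: lerD; apply: ler_pM => //; exact: cpow1_le.
by rewrite -[n.+2%:R]natr1 exprS le_eqVlt; apply/orP; left; apply/eqP; ring.
Qed.

(** The real part deviates from the power of [r] only at second order in [s], at the cost of two
    powers of [rho]. In the induction the error grows by [n.+2%:R], within the gap between
    consecutive squares. *)
Lemma cpow1_close n :
  `|(cpow n.+2).1 - r ^+ n.+2| <= n.+2%:R ^+ 2 * rho ^+ n * s ^+ 2.
Proof.
elim: n => [|n IH].
  rewrite /= expr0 mulr1.
  rewrite (_ : _ - _ = - s ^+ 2); last by ring.
  rewrite normrN ger0_norm ?sqr_ge0// -[leLHS]mul1r ler_wpM2r ?sqr_ge0//.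
  by rewrite -natrX ler1n.
have -> : (cpow n.+3).1 - r ^+ n.+3 =
    ((cpow n.+2).1 - r ^+ n.+2) * r - (cpow n.+2).2 * s.
  by rewrite cpow1S [r ^+ n.+3]exprSr; ring.
apply: (le_trans (ler_normB _ _)); rewrite !normrM.
apply: (@le_trans _ _ (n.+2%:R ^+ 2 * rho ^+ n * s ^+ 2 * rho
   + n.+2%:R * rho ^+ n.+1 * `|s| * `|s|)).
  by apply: lerD; apply: ler_pM => //; exact: cpow2_small.
rewrite -[_ * `|s| * `|s|]mulrA -[`|s| * _]expr2 real_normK ?num_real//.
have -> : n.+2%:R ^+ 2 * rho ^+ n * s ^+ 2 * rho + n.+2%:R * rho ^+ n.+1 * s ^+ 2
  = (n.+2%:R ^+ 2 + n.+2%:R) * (rho ^+ n.+1 * s ^+ 2) by rewrite [rho ^+ n.+1]exprS; ring.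
rewrite -[leRHS]mulrA; apply: ler_wpM2r.
  by rewrite mulr_ge0 ?sqr_ge0 ?exprn_ge0.
have -> : n.+3%:R = n.+2%:R + 1 :> R by rewrite natr1.
have : (0 : R) <= n.+2%:R by exact: ler0n.
by move: (n.+2%:R) => x x0; nra.
Qed.

End complex_powers.

Lemma steps_le m : (0 < m)%N -> ((6 * m).+2 <= 8 * m)%N.
Proof. lia. Qed.

Lemma steps_cube m : (6 * m = 2 * m * 3)%N.
Proof. lia. Qed.

(** * Pointwise lower bound on the frequency integrand *)

Section pointwise_bound.
Context {R : realType}.

Lemma bernoulli_ineq (x : R) n : -1 <= x -> 1 + n%:R * x <= (1 + x) ^+ n.
Proof.
move=> x1; elim: n => [|n IH]; first by rewrite mul0r addr0 expr0.
have n0 : 0 <= n%:R :> R by exact: ler0n.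
rewrite exprSr; apply: (@le_trans _ _ ((1 + n%:R * x) * (1 + x))).
  rewrite -natr1; have : 0 <= n%:R * x ^+ 2 by rewrite mulr_ge0 ?sqr_ge0.
  by lra.
by rewrite ler_wpM2r//; lra.
Qed.

(** Multiply by [(1 + x) ^+ n], which Bernoulli bounds below, and use [(1 - x) * (1 + x) <= 1]. A
    rational bound is convenient because its integral in [t] is an arctangent. *)
Lemma onemX_le (x : R) n : 0 <= x <= 1 -> (1 - x) ^+ n <= (1 + n%:R * x)^-1.
Proof.
move=> /andP[x0 x1].
have nx : 0 < 1 + n%:R * x by rewrite ltr_pwDl// mulr_ge0.
rewrite -[leRHS]mul1r ler_pdivlMr//.
apply: (@le_trans _ _ ((1 - x) ^+ n * (1 + x) ^+ n)).
  by rewrite ler_wpM2l ?exprn_ge0 ?subr_ge0// bernoulli_ineq//; lra.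
rewrite -exprMn exprn_ile1//; first by rewrite mulr_ge0; lra.
have : 0 <= x ^+ 2 by rewrite sqr_ge0.
by lra.
Qed.

Variables (v t r s M : R) (m : nat).
Hypothesis v0 : 0 < v.
Hypothesis v1 : v <= 1 / 4.
Hypothesis t01 : 0 < t <= 1.
Hypothesis s_le : `|s| <= v * t ^+ 3.
Hypothesis r_ge : 1 - 2 * v * t ^+ 2 <= r.
Hypothesis rs_le : r ^+ 2 + s ^+ 2 <= 1 - v * t ^+ 2.
Hypothesis m0 : (0 < m)%N.
Hypothesis M1 : 1 <= M.

(** The two extra powers pay for those lost in [cpow1_close]; the remaining [rho ^+ (6 * m)] yields
    three factors [b], each of which absorbs one factor of order [m%:R * x]. *)
Let N := (6 * m).+2.
Let b := (1 + m%:R * (v * t ^+ 2))^-1.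
Let rho := Num.sqrt (r ^+ 2 + s ^+ 2).
Let x := v * t ^+ 2.

Let t0 : 0 < t. Proof. by case/andP: t01. Qed.
Let t1 : t <= 1. Proof. by case/andP: t01. Qed.
Let x0 : 0 < x. Proof. by rewrite mulr_gt0// exprn_gt0. Qed.
Let t2_le1 : t ^+ 2 <= 1. Proof. by rewrite exprn_ile1// ltW. Qed.
Let x1 : x <= 1 / 4.
Proof. by rewrite (le_trans _ v1)// /x ler_piMr// ltW. Qed.
Let r0 : 0 <= r. Proof. by move: r_ge; rewrite -mulrA -/x; have := x1; lra. Qed.
Let rho0 : 0 <= rho. Proof. exact: sqrtr_ge0. Qed.
Let rhoE : rho ^+ 2 = r ^+ 2 + s ^+ 2.
Proof. by rewrite sqr_sqrtr// addr_ge0 ?sqr_ge0. Qed.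
Let mR0 : 0 < m%:R :> R. Proof. by rewrite ltr0n. Qed.
Let D0 : 0 < 1 + m%:R * x. Proof. by rewrite ltr_pwDl// mulr_ge0// ltW. Qed.
Let b0 : 0 < b. Proof. by rewrite invr_gt0. Qed.
Let b1 : b <= 1.
Proof. by rewrite invf_le1// lerDl mulr_ge0// ltW. Qed.
Let mxb : m%:R * x * b <= 1.
Proof. by rewrite ler_pdivrMr// mul1r lerDr. Qed.
Let N_le : N%:R <= 8 * m%:R :> R.
Proof.
by have := steps_le m0; rewrite -(ler_nat R) natrM.
Qed.
Let Nxb : N%:R * x * b <= 8.
Proof.
have xb0 : 0 <= x * b by rewrite mulr_ge0// ltW.
have := ler_wpM2r xb0 N_le; have := mxb; rewrite !mulrA; lra.
Qed.
Let rho_le1 : rho <= 1.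
Proof.
have : rho ^+ 2 <= 1 ^+ 2 by rewrite rhoE expr1n; have := x0; move: rs_le; rewrite -/x; lra.
by rewrite ler_pXn2r ?nnegrE.
Qed.
Let rho6m : rho ^+ (6 * m) <= b ^+ 3.
Proof.
rewrite (_ : (6 * m = 2 * m * 3)%N); last exact: steps_cube.
rewrite exprM lerXn2r ?nnegrE ?exprn_ge0 ?(ltW b0)//.
rewrite exprM rhoE; apply: (@le_trans _ _ ((1 - x) ^+ m)).
  apply: lerXn2r => //; rewrite nnegrE; first by rewrite addr_ge0 ?sqr_ge0.
  by have := x1; lra.
by rewrite /b -/x; apply: onemX_le; have := x0; have := x1; lra.
Qed.
Let b3_le : b ^+ 3 <= b.
Proof. by rewrite exprS ler_piMr ?(ltW b0)// exprn_ile1// ltW. Qed.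
Let rhoN : rho ^+ N <= b.
Proof.
apply: le_trans b3_le; apply: le_trans rho6m.
by rewrite /N -addn2 exprD ler_piMr ?exprn_ge0// exprn_ile1.
Qed.

Let c := (cpow r s N).1.
Let e := (cpow r s N).2.

Let cpow1_le_decay : `|c| <= b.
Proof. exact: le_trans (cpow1_le rho0 rhoE N) rhoN. Qed.

Let cpow2_le_decay : `|e| <= b.
Proof. exact: le_trans (cpow2_le rho0 rhoE N) rhoN. Qed.

(** One factor [b] absorbs [N%:R * x], leaving [t], which will cancel the [t^-1] in front of the
    sine part; a second [b] keeps the bound integrable at the scale [1 / sqrt (m * v)]. *)
Let cpow2_le_linear : `|e| <= 8 * b * t.
Proof.
apply: (le_trans (cpow2_small rho0 rhoE _)); rewrite -/N.
have h : rho ^+ (6 * m).+1 <= b ^+ 3.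
  by apply: le_trans rho6m; rewrite exprSr ler_piMr ?exprn_ge0.
apply: (@le_trans _ _ (N%:R * b ^+ 3 * (v * t ^+ 3))).
  by apply: ler_pM => //; rewrite ?mulr_ge0 ?exprn_ge0// ler_wpM2l.
rewrite [leLHS](_ : _ = N%:R * x * b * (b * (b * t))); last first.
  by rewrite /x; move: (N%:R) (b) => n' b'; ring.
rewrite -[leRHS]mulrA; apply: ler_pM => //.
- by rewrite !mulr_ge0// ltW.
- by rewrite !mulr_ge0// ltW.
- by rewrite ler_piMl// mulr_ge0// ltW.
Qed.

(** After multiplication by [m%:R * v] the bound regroups as [(N%:R * x * b) ^+ 2 * (m%:R * x * b)],
    at most [8 ^+ 2 * 1]; this uses up all three factors [b]. *)
Let cpow1_close_decay : `|c - r ^+ N| <= 64 / (m%:R * v).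
Proof.
apply: (le_trans (cpow1_close rho0 rhoE _)); rewrite -/N.
have s2 : s ^+ 2 <= (v * t ^+ 3) ^+ 2.
  rewrite -(real_normK (num_real s)) lerXn2r ?nnegrE//.
  by rewrite mulr_ge0 ?exprn_ge0 ?(ltW v0) ?(ltW t0).
have h1 : N%:R ^+ 2 * rho ^+ (6 * m) * s ^+ 2 <=
    N%:R ^+ 2 * b ^+ 3 * (v * t ^+ 3) ^+ 2.
  apply: ler_pM => //.
  - by rewrite mulr_ge0 ?sqr_ge0 ?exprn_ge0.
  - exact: sqr_ge0.
  - by rewrite ler_wpM2l ?sqr_ge0.
apply: (le_trans h1); have mv : 0 < m%:R * v by rewrite mulr_gt0.
rewrite ler_pdivlMr//.
rewrite [leLHS](_ : _ = (N%:R * x * b) ^+ 2 * (m%:R * x * b)); last first.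
  by rewrite /x; move: (N%:R) (b) => n' b'; ring.
rewrite -[leRHS]mulr1; apply: ler_pM => //.
- by rewrite sqr_ge0.
- by rewrite !mulr_ge0// ltW.
rewrite (_ : 64 = 8 ^+ 2); last by ring.
by rewrite lerXn2r ?nnegrE// !mulr_ge0// ltW.
Qed.

Let rX_le_decay : 0 <= r ^+ N <= b.
Proof.
rewrite exprn_ge0//=; apply: le_trans rhoN; rewrite lerXn2r ?nnegrE//.
have : r ^+ 2 <= rho ^+ 2 by rewrite rhoE lerDl sqr_ge0.
by rewrite ler_pXn2r ?nnegrE.
Qed.

Let rX_ge : 1 - N%:R * (2 * x) <= r ^+ N.
Proof.
have := x1 => x14; have := x0 => x00.
apply: (@le_trans _ _ ((1 - 2 * x) ^+ N)).
  by rewrite -mulrN; apply: bernoulli_ineq; lra.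
by rewrite lerXn2r ?nnegrE//; move: r_ge; rewrite -mulrA -/x; lra.
Qed.

Variables C delta : R.
Hypothesis C0 : 0 <= C.
Hypothesis delta0 : 0 < delta.
Hypothesis deltaM : delta * M <= 1.
Hypothesis delta4 : delta <= 1 / 4.
Hypothesis deltaN : (6 * m).+2%:R * (2 * (v * delta ^+ 2)) <= 1 / 2.

Let M0 : 0 < M. Proof. by move: M1; lra. Qed.
Let k0 : 0 <= taper t. Proof. by rewrite taper_ge0// (ltW t0). Qed.
Let k1 : taper t <= 1. Proof. by rewrite taper_le1// (ltW t0). Qed.
Let mv0 : 0 < m%:R * v. Proof. by rewrite mulr_gt0. Qed.

Let sin_div_le : `|sin (t * M) / t| <= M.
Proof.
rewrite normf_div (gtr0_norm t0) ler_pdivrMr//.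
by rewrite (le_trans (norm_sin_le _))// gtr0_norm ?mulr_gt0// mulrC.
Qed.

Let sin_div_ge : t * M <= 1 -> M / 2 <= sin (t * M) / t.
Proof.
move=> tM; have tM0 : 0 <= t * M by rewrite mulr_ge0// ltW.
rewrite ler_pdivlMr//; have := sin_ge_quadratic tM0.
have : 0 <= t * M * (1 - t * M) by rewrite mulr_ge0// subr_ge0.
by lra.
Qed.

(** Three zones. Up to [delta] the factors are at least 1/2, [M / 2] and 1/2. From there to [1 / M]
    the product is nonnegative. Beyond [1 / M] the sine may be negative, but [r ^+ N] has already
    decayed. *)
Let main_term : M / 8 * (t <= delta)%R%:R - M ^+ 3 / (m%:R * v)
  <= taper t * (sin (t * M) / t) * r ^+ N.
Proof.
have /andP[rN0 rNb] := rX_le_decay.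
have M3 : 0 <= M ^+ 3 / (m%:R * v).
  by rewrite divr_ge0 ?exprn_ge0 ?(ltW M0) ?(ltW mv0).
have [td|td] := leP t delta.
  have tM : t * M <= 1 by rewrite (le_trans _ deltaM)// ler_wpM2r// ltW.
  have t2 : t ^+ 2 <= delta ^+ 2 by rewrite lerXn2r ?nnegrE ?(ltW t0) ?(ltW delta0).
  have rN : 1 / 2 <= r ^+ N.
    apply: le_trans rX_ge.
    have : N%:R * (2 * x) <= N%:R * (2 * (v * delta ^+ 2)).
      by rewrite ler_wpM2l// ler_wpM2l// ler_wpM2l// ltW.
    by move: deltaN; rewrite -/N; lra.
  have kt : 1 / 2 <= taper t.
    have : t ^+ 2 <= (1 / 4) ^+ 2.
      by apply: lerXn2r; rewrite ?nnegrE; have := t0; move: delta4 td; lra.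
    have : 0 <= t ^+ 3 * (1 - t ^+ 2).
      by rewrite mulr_ge0 ?exprn_ge0 ?(ltW t0)// subr_ge0.
    have : 0 <= t ^+ 3 by rewrite exprn_ge0// ltW.
    by rewrite /taper; lra.
  apply: (@le_trans _ _ (1 / 2 * (M / 2) * (1 / 2))); first by rewrite mulr1; lra.
  have hM := M0.
  by apply: ler_pM => //; [lra|apply: ler_pM => //; [lra|exact: sin_div_ge]].
rewrite mulr0 sub0r; have [tM|tM] := leP (t * M) 1.
  apply: (@le_trans _ _ 0); first by rewrite oppr_le0.
  apply: mulr_ge0 => //; apply: mulr_ge0 => //; apply: le_trans (sin_div_ge tM).
  by have := M0; lra.
(* [b] is at most [1 / (m * v * t ^+ 2)], and here [1 / t] is below [M]. *)
have bM : b <= M ^+ 2 / (m%:R * v).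
  rewrite ler_pdivlMr// (_ : b * _ = m%:R * x * b * (t ^+ 2)^-1); last first.
    by rewrite /x; field; rewrite gt_eqF// exprn_gt0.
  rewrite -[leRHS]mul1r; apply: ler_pM => //.
    by rewrite !mulr_ge0// ltW.
    by rewrite invr_ge0 sqr_ge0.
  rewrite -[M ^+ 2]invrK lef_pV2 ?posrE ?invr_gt0 ?exprn_gt0//.
  rewrite -exprVn lerXn2r ?nnegrE ?invr_ge0 ?(ltW M0) ?(ltW t0)//.
  by rewrite -[M^-1]mul1r ler_pdivrMr// ltW.
rewrite lerNl; apply: (le_trans (ler_norm _)).
rewrite normrN normrM (ger0_norm rN0) normrM (ger0_norm k0).
rewrite [M ^+ 3]exprS -[leRHS]mulrA; apply: ler_pM => //.
- by rewrite mulr_ge0.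
- by rewrite -[leRHS]mul1r ler_pM.
- exact: le_trans rNb bM.
Qed.

(** [64 * M] is the cost of replacing [c] by [r ^+ N], [M ^+ 3] comes from the far zone of the main
    term, 8 from the imaginary part and [4 * C] from the envelope. The coefficient of [b], whose
    integral is of the leading order, does not involve [M]. *)
Let integrand_lower :
  M / 8 * (t <= delta)%R%:R - (4 * C + 8) * b - (64 * M + M ^+ 3) / (m%:R * v) <=
  taper t / t * (sin (t * M) * c + cos (t * M) * e)
  - C * ((1 - t) * (1 + cos (pi * t))) * (cos (t * M) * c - sin (t * M) * e).
Proof.
have T2 : - (M * (64 / (m%:R * v))) <= taper t * (sin (t * M) / t) * (c - r ^+ N).
  rewrite lerNl; apply: (le_trans (ler_norm _)); rewrite normrN normrM.
  apply: ler_pM => //.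
  rewrite normrM (ger0_norm k0) -[leRHS]mul1r.
  exact: ler_pM.
have T3 : - (8 * b) <= taper t * (cos (t * M) * (e / t)).
  rewrite lerNl; apply: (le_trans (ler_norm _)); rewrite normrN !normrM.
  rewrite (ger0_norm k0) -[leRHS]mul1r; apply: ler_pM => //.
  rewrite -[leRHS]mul1r; apply: ler_pM => //; first exact: cos_max.
  by rewrite normfV (gtr0_norm t0) ler_pdivrMr.
have T4 : C * ((1 - t) * (1 + cos (pi * t))) * (cos (t * M) * c - sin (t * M) * e)
    <= C * 2 * (2 * b).
  apply: (le_trans (ler_norm _)); rewrite normrM; apply: ler_pM => //.
    rewrite normrM (ger0_norm C0) ler_wpM2l// normrM -[leRHS]mul1r.
    have tt0 := t0; have tt1 := t1.
    apply: ler_pM => //; first by rewrite ler_norml; lra.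
    have := cos_le1 (pi * t); have := cos_geN1 (pi * t).
    by rewrite ler_norml; lra.
  apply: (le_trans (ler_normB _ _)); rewrite !normrM mulr_natl mulr2n.
  apply: lerD; rewrite -[leRHS]mul1r; apply: ler_pM => //.
  - exact: cos_max.
  - exact: sin_max.
have -> : taper t / t * (sin (t * M) * c + cos (t * M) * e) =
    taper t * (sin (t * M) / t) * r ^+ N
    + taper t * (sin (t * M) / t) * (c - r ^+ N)
    + taper t * (cos (t * M) * (e / t)).
  by move: (r ^+ N) => q; ring.
move: main_term T2 T3 T4.
move: (taper t * _ * r ^+ N) (taper t * _ * (c - _)) (taper t * (cos _ * _)).
move: (C * ((1 - t) * _) * _) => A1 A2 A3 A4.
move: (m%:R * v)^-1 ((t <= delta)%R%:R) (b) => w q b'.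
by lra.
Qed.

Lemma minorant_integrand_lower :
  M / 8 * (t <= delta)%R%:R - (4 * C + 8) * (1 + m%:R * (v * t ^+ 2))^-1
    - (64 * M + M ^+ 3) / (m%:R * v) <=
  taper t / t * (sin (t * M) * (cpow r s (6 * m).+2).1
                 + cos (t * M) * (cpow r s (6 * m).+2).2)
  - C * ((1 - t) * (1 + cos (pi * t)))
    * (cos (t * M) * (cpow r s (6 * m).+2).1
       - sin (t * M) * (cpow r s (6 * m).+2).2).
Proof. exact: integrand_lower. Qed.

End pointwise_bound.

(** * Integration of the bound and the lower tail *)

Section lower_tail.
Context {R : realType}.
Local Notation mu := (@lebesgue_measure R).

Lemma decay_integral (k : R) : 0 < k ->
  mu.-integrable unit_itv (EFin \o (fun t => (1 + k * t ^+ 2)^-1)) /\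
  \int[mu]_(t in unit_itv) (1 + k * t ^+ 2)^-1 <= pi / 2 / Num.sqrt k.
Proof.
move=> k0; set u := Num.sqrt k.
have u0 : 0 < u by rewrite sqrtr_gt0.
have u2 : u ^+ 2 = k by rewrite sqr_sqrtr// ltW.
have D0 t : 1 + k * t ^+ 2 != 0.
  by rewrite gt_eqF// ltr_pwDl// mulr_ge0 ?sqr_ge0// ltW.
have cf : continuous (fun t : R => (1 + k * t ^+ 2)^-1).
  apply: der_continuous => t; eexists.
  by apply: derV; [exact: D0|derive].
split; first exact: continuous_unit_integrable.
rewrite (@unit_FTC R _ (fun t : R => atan (u * t) / u))//.
  rewrite mulr0 atan0 mul0r subr0 mulr1 ler_wpM2r ?invr_ge0 ?(ltW u0)//.
  exact/ltW/atan_ltpi2.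
move=> t; apply: der_eq.
  apply: derM; last exact: der_cst.
  by apply: der_atan; derive.
by rewrite /= !mulr0 add0r addr0 mulr1 exprMn u2 mulrCA mulVf ?gt_eqF// mulr1.
Qed.

Lemma initial_segment_integral (delta : R) : 0 < delta <= 1 ->
  mu.-integrable unit_itv (EFin \o (fun t => (t <= delta)%R%:R : R)) /\
  \int[mu]_(t in unit_itv) ((t <= delta)%R%:R : R) = delta.
Proof.
move=> /andP[d0 d1].
have fE : {in unit_itv, (fun t : R => (t <= delta)%R%:R : R) =1
    (\1_(`]0, delta]%classic : set R) : R -> R)}.
  move=> t tD; have /andP[t0 t1] := unit_itvP (set_mem tD).
  by rewrite indicE/= mem_setE in_itv/= t0.
have eqI : (`]0, delta]%classic : set R) `&` unit_itv = `]0, delta]%classic.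
  apply/setIidPl => t; rewrite /unit_itv/= !in_itv/= => /andP[-> td].
  exact: le_trans td d1.
split.
  apply: (bounded_unit_integrable (M := 1)); last first.
    by move=> t _; case: (t <= delta) => /=; rewrite ?normr1 ?normr0.
  apply: (eq_measurable_fun (\1_(`]0, delta]%classic : set R) : R -> R)).
    by move=> t tD; rewrite fE.
  by apply: measurable_funTS; exact: measurable_indic.
rewrite (eq_Rintegral _ fE) /Rintegral integral_indic// eqI.
have muE : mu `]0, delta]%classic = delta%:E.
  by rewrite lebesgue_measure_itv/= lte_fin d0 sube0.
by rewrite [X in fine X](_ : _ = delta%:E)//; exact: muE.
Qed.

(** With [u = sqrt (m * v)], the gain [M / 8 * delta] is [M / 64 / u], and the decay term costs at
    most [(4 * C + 8) * (pi / 2) / u]. This choice of [M] leaves exactly [1 / u] for the terms of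
    order [1 / u ^+ 2]. *)
Definition tail_shift : R := 64 * ((4 * minorant_coef + 8) * (pi / 2) + 1).

Variables (d : measure_display) (T : measurableType d) (P : probability T R).
Variables (Y : T -> R) (v : R) (m : nat) (r s : R -> R).
Hypothesis mY : measurable_fun setT Y.
Hypothesis iY : P.-integrable setT (EFin \o Y).
Hypothesis v0 : 0 < v.
Hypothesis v1 : v <= 1 / 4.
Hypothesis s_le   : forall t : R, unit_itv t -> `|s t| <= v * t ^+ 3.
Hypothesis r_ge   : forall t : R, unit_itv t -> 1 - 2 * v * t ^+ 2 <= r t.
Hypothesis rs_le   : forall t : R, unit_itv t ->
  r t ^+ 2 + s t ^+ 2 <= 1 - v * t ^+ 2.
Hypothesis cosY   : forall t : R, unit_itv t ->
  cos_mean P Y t = (cpow (r t) (s t) (6 * m).+2).1.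
Hypothesis sinY   : forall t : R, unit_itv t ->
  sin_mean P Y t = (cpow (r t) (s t) (6 * m).+2).2.
Hypothesis m_large :
  (64 * tail_shift + tail_shift ^+ 3) ^+ 2 < m%:R * v.

Local Notation C := (@minorant_coef R).
Local Notation M := tail_shift.
Let Z w := Y w + M.
Let u := Num.sqrt (m%:R * v).
(** The width on which [r ^+ N] stays above 1/2: [N%:R * (2 * (v * delta ^+ 2))] is at most
    [16 * u ^+ 2 * delta ^+ 2 = 1 / 4]. *)
Let delta := (8 * u)^-1.

Let C0 : 0 <= C. Proof. by rewrite mulr_ge0 ?sqr_ge0. Qed.
Let M64 : 64 <= M.
Proof.
rewrite /M; have : 0 <= (4 * C + 8) * (pi / 2).
  apply: mulr_ge0; last by rewrite divr_ge0 ?pi_ge0.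
  by have := C0; lra.
by lra.
Qed.
Let M3 : 0 <= M ^+ 3. Proof. by rewrite exprn_ge0//; have := M64; lra. Qed.
Let mv0 : 0 < m%:R * v. Proof. exact: le_lt_trans (sqr_ge0 _) m_large. Qed.
Let u0 : 0 < u. Proof. by rewrite sqrtr_gt0. Qed.
Let u2 : u ^+ 2 = m%:R * v. Proof. by rewrite sqr_sqrtr// ltW. Qed.
Let u_gt : 64 * M + M ^+ 3 < u.
Proof.
have h0 : 0 <= 64 * M + M ^+ 3 by have := M64; have := M3; lra.
by have := m_large; rewrite -u2 ltr_pXn2r ?nnegrE ?(ltW u0).
Qed.
Let m0 : (0 < m)%N.
Proof. by have := mv0; rewrite pmulr_lgt0// ltr0n. Qed.
Let delta0 : 0 < delta. Proof. by rewrite invr_gt0 mulr_gt0. Qed.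
Let deltaM : delta * M <= 1.
Proof.
rewrite mulrC ler_pdivrMr ?mulr_gt0// mul1r.
by have := M64; have := M3; have := u_gt; lra.
Qed.
Let delta4 : delta <= 1 / 4.
Proof.
rewrite -[delta]mul1r ler_pdivrMr ?mulr_gt0//.
by have := M64; have := M3; have := u_gt; lra.
Qed.
Let deltaN : (6 * m).+2%:R * (2 * (v * delta ^+ 2)) <= 1 / 2.
Proof.
have Nm : (6 * m).+2%:R <= 8 * m%:R :> R.
  by have := steps_le m0; rewrite -(ler_nat R) natrM.
apply: (@le_trans _ _ (8 * m%:R * (2 * (v * delta ^+ 2)))).
  by rewrite ler_wpM2r// !mulr_ge0 ?sqr_ge0// ltW.
rewrite [leLHS](_ : _ = 16 * (m%:R * v) * delta ^+ 2); last by ring.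
rewrite -u2 [leLHS](_ : _ = 1 / 4); first by lra.
have : u != 0 by rewrite gt_eqF.
by rewrite /delta; move: (u) => u' u'0; field.
Qed.

Let mZ : measurable_fun setT Z. Proof. exact: measurable_funD. Qed.
Let iZ : P.-integrable setT (EFin \o Z).
Proof.
have iM : P.-integrable setT (EFin \o cst M).
  by apply: (@bounded_integrable _ _ _ P (cst M) `|M|).
exact: (integrableD measurableT iY iM).
Qed.

Let cosZ t : unit_itv t -> cos_mean P Z t =
  cos (t * M) * (cpow (r t) (s t) (6 * m).+2).1
  - sin (t * M) * (cpow (r t) (s t) (6 * m).+2).2.
Proof.
move=> tD; rewrite -cosY// -sinY// /cos_mean /sin_mean.
have ic := integrable_cosM P t mY; have is' := integrable_sinM P t mY.
rewrite -!RintegralZl// -RintegralB//; last 2 first.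
  exact: (integrableZl measurableT (cos (t * M)) ic).
  exact: (integrableZl measurableT (sin (t * M)) is').
by apply: eq_Rintegral => w _; rewrite /Z mulrDr cosD; ring.
Qed.

Let sinZ t : unit_itv t -> sin_mean P Z t =
  sin (t * M) * (cpow (r t) (s t) (6 * m).+2).1
  + cos (t * M) * (cpow (r t) (s t) (6 * m).+2).2.
Proof.
move=> tD; rewrite -cosY// -sinY// /cos_mean /sin_mean.
have ic := integrable_cosM P t mY; have is' := integrable_sinM P t mY.
rewrite -!RintegralZl// -RintegralD//; last 2 first.
  exact: (integrableZl measurableT (sin (t * M)) ic).
  exact: (integrableZl measurableT (cos (t * M)) is').
by apply: eq_Rintegral => w _; rewrite /Z mulrDr sinD; ring.
Qed.

Let expected_minorant_gt0 : 0 < \int[P]_w minorant (Z w).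
Proof.
have d1 : 0 < delta <= 1 by have := delta0; have := delta4; lra.
have [iseg segE] := initial_segment_integral d1.
have [idec decE] := decay_integral mv0.
pose K := (64 * M + M ^+ 3) / (m%:R * v).
have iseg' := integrableZl measurable_unit_itv (M / 8) iseg.
have idec' := integrableZl measurable_unit_itv (4 * C + 8) idec.
have icst : mu.-integrable unit_itv (EFin \o (fun=> K)).
  exact: continuous_unit_integrable (@cst_continuous _ _ _).
have lowE : \int[mu]_(t in unit_itv)
    (M / 8 * ((t <= delta)%R%:R : R) - (4 * C + 8) * (1 + m%:R * v * t ^+ 2)^-1 - K)
  = M / 8 * delta
    - (4 * C + 8) * \int[mu]_(t in unit_itv) (1 + m%:R * v * t ^+ 2)^-1 - K.
  rewrite RintegralB//; last exact: (integrableB measurable_unit_itv iseg' idec').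
  rewrite RintegralB//; congr (_ - _ - _).
  - by rewrite RintegralZl//; congr (_ * _); exact: segE.
  - by rewrite RintegralZl.
  - exact: unit_Rintegral_cst.
apply: (@lt_le_trans _ _ (M / 8 * delta
    - (4 * C + 8) * \int[mu]_(t in unit_itv) (1 + m%:R * v * t ^+ 2)^-1 - K)).
  have C0' := C0; have u0' := u0.
  have M_E : M / 64 = (4 * C + 8) * (pi / 2) + 1 by rewrite /tail_shift; lra.
  (* This is where [m_large] acts: [u] exceeds the numerator of [K]. *)
  have K_lt : K < u^-1.
    rewrite /K -u2 ltr_pdivrMr ?exprn_gt0// expr2 mulKf ?gt_eqF//.
  have seg : M / 8 * delta = M / 64 / u.
    by rewrite /delta; field; rewrite gt_eqF.
  have : (4 * C + 8) * \int[mu]_(t in unit_itv) (1 + m%:R * v * t ^+ 2)^-1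
      <= (4 * C + 8) * (pi / 2 / u) by rewrite ler_wpM2l//; lra.
  rewrite seg M_E [(_ + 1) / u]mulrDl mul1r -[_ * (pi / 2) / u]mulrA.
  by move: K_lt; lra.
rewrite -lowE (expected_minorantE mZ iZ); apply: le_Rintegral => //.
- exact: (integrableB measurable_unit_itv
    (integrableB measurable_unit_itv iseg' idec') icst).
- exact: integrable_expected_minorant.
move=> t tD; rewrite cosZ// sinZ//.
have M1 : 1 <= M by have := M64; lra.
have := minorant_integrand_lower v0 v1 (unit_itvP tD) (s_le tD) (r_ge tD)
  (rs_le tD) m0 M1 C0 delta0 deltaM delta4 deltaN.
by rewrite [m%:R * (v * _)]mulrA.
Qed.

(** [minorant (Z w)] is at most [L] off [A] and at most [- L] on [A], so its positive mean is at
    most [L * (1 - 2 * P A)]; since [0 <= L], this forces [P A < 1/2]. *)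
Lemma lower_tail_lt : (P [set w | (Y w <= - M)%R] < (1 / 2)%:E)%E.
Proof.
set A := [set w | _].
have mA : measurable A.
  rewrite (_ : A = Y @^-1` `]-oo, (- M)]%classic); last first.
    by apply/seteqP; split => w; rewrite /A/= in_itv.
  by rewrite -[X in measurable X]setTI; exact: mY.
have iA : P.-integrable setT (EFin \o (\1_A : T -> R)).
  apply: (@bounded_integrable _ _ _ P _ 1); first exact: measurable_indic.
  by move=> w; rewrite indicE; case: (w \in A); rewrite ?normr1 ?normr0.
pose L : R := ssign_lim.
have L0 : 0 <= L by exact: ssign_lim_ge0.
have le1 w : minorant (Z w) <= L - 2 * L * \1_A w.
  have [wA|wA] := boolP (w \in A); rewrite indicE.
    rewrite wA; have := set_mem wA; rewrite /A/= => YM.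
    have : Z w <= 0 by rewrite /Z; lra.
    by move=> /minorant_leN; rewrite -/L; lra.
  rewrite (negbTE wA) mulr0 subr0; apply: minorant_le; rewrite /Z.
  by move: wA; rewrite notin_setE /A/= => /negP; rewrite -ltNge; lra.
have iL : P.-integrable setT (EFin \o (fun=> L)).
  by apply: (@bounded_integrable _ _ _ P (cst L) `|L|).
have i2A := integrableZl measurableT (2 * L) iA.
have intA : \int[P]_w (\1_A w : R) = fine (P A).
  by rewrite /Rintegral integral_indic// setIT.
have := expected_minorant_gt0.
have : \int[P]_w minorant (Z w) <= L - 2 * L * fine (P A).
  apply: (@le_trans _ _ (\int[P]_w (L - 2 * L * \1_A w))).
    apply: le_Rintegral => //; first exact: integrable_minorant.
    exact: (integrableB measurableT iL i2A).
  rewrite RintegralB// RintegralZl// intA Rintegral_cst//.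
  by rewrite [X in fine X](_ : _ = 1%E) ?mulr1//; exact: probability_setT.
move=> h1 h2; have PA : P A \is a fin_num by rewrite fin_num_measure.
rewrite -(fineK PA) lte_fin ltNge; apply/negP => p2.
have : 0 <= L * (2 * fine (P A) - 1) by rewrite mulr_ge0//; lra.
by lra.
Qed.

End lower_tail.

(** * Characteristic functions of i.i.d. sums *)

Section iid_sums.
Context d (T : measurableType d) (R : realType) (P : probability T R).

Lemma iid_comp (X : nat -> T -> R) (g : R -> R) : measurable_fun setT g ->
  iid P X -> iid P (fun k w => g (X k w)).
Proof.
move=> mg [mX [indX idX]].
have mgB (B : set R) : measurable B -> measurable (g @^-1` B).
  by move=> mB; rewrite -[X in measurable X]setTI; exact: mg.
split; first by move=> k; apply: measurableT_comp.
split.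
  move=> J B uJ mB.
  exact: (indX J (fun j => g @^-1` B j) uJ (fun j => mgB _ (mB j))).
by move=> k B mB; exact: (idX k _ (mgB _ mB)).
Qed.

Lemma indep2_comp (X Y : T -> R) (f g : R -> R) :
  measurable_fun setT f -> measurable_fun setT g ->
  indep2 P X Y -> indep2 P (fun w => f (X w)) (fun w => g (Y w)).
Proof.
move=> mf mg XY A B mA mB; apply: (XY (f @^-1` A) (g @^-1` B)).
  by rewrite -[X in measurable X]setTI; exact: mf.
by rewrite -[X in measurable X]setTI; exact: mg.
Qed.

Lemma indep2_RintegralM (X Y : T -> R) :
  measurable_fun setT X -> measurable_fun setT Y -> indep2 P X Y ->
  P.-integrable setT (EFin \o X) -> P.-integrable setT (EFin \o Y) ->
  P.-integrable setT (EFin \o (fun w => X w * Y w)) /\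
  \int[P]_w (X w * Y w) = (\int[P]_w X w) * (\int[P]_w Y w).
Proof.
move=> mX mY XY iX iY.
pose X' : {mfun T >-> R} := mfun_Sub (mem_set mX).
pose Y' : {mfun T >-> R} := mfun_Sub (mem_set mY).
have [iXY XYE] := @indep2_integralM _ _ _ P X' Y' XY iX iY.
split; first exact: iXY.
rewrite /Rintegral -fineM; [|exact: integrable_fin_num|exact: integrable_fin_num].
by congr fine; exact: XYE.
Qed.

Lemma identical_Rintegral (X Y : T -> R) (g : R -> R) :
  measurable_fun setT X -> measurable_fun setT Y -> measurable_fun setT g ->
  (forall B : set R, measurable B -> P (X @^-1` B) = P (Y @^-1` B)) ->
  P.-integrable setT (EFin \o (fun w => g (X w))) ->
  P.-integrable setT (EFin \o (fun w => g (Y w))) /\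
  \int[P]_w g (Y w) = \int[P]_w g (X w).
Proof.
move=> mX mY mg XY igX.
pose X' : {mfun T >-> R} := mfun_Sub (mem_set mX).
pose Y' : {mfun T >-> R} := mfun_Sub (mem_set mY).
have mEg : measurable_fun setT (EFin \o g) by exact/measurable_EFinP.
have igY : P.-integrable setT ((EFin \o g) \o Y').
  apply/integrableP; split; first exact: measurableT_comp.
  rewrite -(ge0_integral_distribution Y' (f := fun z => `|(EFin \o g) z|%E))//;
    last exact: measurableT_comp.
  rewrite (eq_measure_integral (distribution P X')); last first.
    by move=> A mA _; exact/esym/(XY A mA).
  rewrite ge0_integral_distribution//; last exact: measurableT_comp.
  by case/integrableP : igX.
split; first exact: igY.
rewrite /Rintegral; congr fine.
rewrite -(integral_distribution (X := Y') mEg igY).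
rewrite (eq_measure_integral (distribution P X')); last first.
  by move=> A mA _; exact/esym/(XY A mA).
by rewrite integral_distribution.
Qed.

Variable X : nat -> T -> R.
Hypothesis iidX : iid P X.

Local Notation S n := (fun w => \sum_(k < n) X k w).

Let mX k : measurable_fun setT (X k). Proof. by case: iidX. Qed.
Let indX : mutually_independent P X. Proof. by case: iidX => _ []. Qed.
Let idX : identically_distributed P X. Proof. by case: iidX => _ []. Qed.

Lemma measurable_iid_sum n : measurable_fun setT (S n).
Proof. exact: measurable_sum. Qed.
Let mS := measurable_iid_sum.

Let indS n : indep2 P (S n) (X n).
Proof. exact: sum_indep_next. Qed.

(** Multiplicativity of the characteristic function, in coordinates: the addition formulas split
    each step into four expectations of independent products. *)
Lemma trig_mean_sum t n :
  cos_mean P (S n) t = (cpow (cos_mean P (X 0%N) t) (sin_mean P (X 0%N) t) n).1 /\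
  sin_mean P (S n) t = (cpow (cos_mean P (X 0%N) t) (sin_mean P (X 0%N) t) n).2.
Proof.
have mcos : measurable_fun setT (fun x : R => cos (t * x)).
  exact: (@measurable_cosM _ R R id t).
have msin : measurable_fun setT (fun x : R => sin (t * x)).
  exact: (@measurable_sinM _ R R id t).
have cosX n' : cos_mean P (X n') t = cos_mean P (X 0%N) t.
  have [] // := @identical_Rintegral (X 0%N) (X n') _ (mX _) (mX _) mcos.
    by move=> B mB; rewrite idX.
  exact: integrable_cosM.
have sinX n' : sin_mean P (X n') t = sin_mean P (X 0%N) t.
  have [] // := @identical_Rintegral (X 0%N) (X n') _ (mX _) (mX _) msin.
    by move=> B mB; rewrite idX.
  exact: integrable_sinM.
elim: n => [|n [IHc IHs]].
  have S0 w : \sum_(k < 0) X k w = 0 by rewrite big_ord0.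
  have P1 : fine (P setT) = 1 by rewrite probability_setT.
  split; rewrite /cos_mean /sin_mean.
    under eq_Rintegral => w _ do rewrite S0 mulr0 cos0.
    by rewrite Rintegral_cst// mul1r; exact: P1.
  under eq_Rintegral => w _ do rewrite S0 mulr0 sin0.
  by rewrite Rintegral_cst// mul0r.
rewrite cpow1S cpow2S -IHc -IHs -(cosX n) -(sinX n).
have icS := integrable_cosM P t (mS n); have isS := integrable_sinM P t (mS n).
have icX := integrable_cosM P t (mX n); have isX := integrable_sinM P t (mX n).
have mcS := measurable_cosM t (mS n); have msS := measurable_sinM t (mS n).
have mcX := measurable_cosM t (mX n); have msX := measurable_sinM t (mX n).
have [icc ccE] := indep2_RintegralM mcS mcX (indep2_comp mcos mcos (@indS n)) icS icX.
have [iss ssE] := indep2_RintegralM msS msX (indep2_comp msin msin (@indS n)) isS isX.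
have [ics csE] := indep2_RintegralM mcS msX (indep2_comp mcos msin (@indS n)) icS isX.
have [isc scE] := indep2_RintegralM msS mcX (indep2_comp msin mcos (@indS n)) isS icX.
rewrite /cos_mean /sin_mean -ccE -ssE -csE -scE -RintegralB// -RintegralD//.
split; apply: eq_Rintegral => w _; rewrite big_ord_recr/= mulrDr.
  by rewrite cosD.
by rewrite sinD addrC.
Qed.

End iid_sums.

(** * Moment bounds on the characteristic function *)

Section third_moment.
Context d (T : measurableType d) (R : realType) (P : probability T R).
Variable Y : T -> R.
Hypothesis mY : measurable_fun setT Y.
Hypothesis iY3 : P.-integrable setT (EFin \o (fun w => `|Y w| ^+ 3)).

Let cube_ge (x : R) : 0 <= x -> x <= 1 + x ^+ 3 /\ x ^+ 2 <= 1 + x ^+ 3.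
Proof.
move=> x0; have [x1|/ltW x1] := leP x 1.
  have x3 : 0 <= x ^+ 3 by rewrite exprn_ge0.
  have x2 : x ^+ 2 <= 1 by rewrite exprn_ile1.
  by split; lra.
have x2 : x ^+ 1 <= x ^+ 3 by exact: ler_weXn2l.
have x3 : x ^+ 2 <= x ^+ 3 by exact: ler_weXn2l.
by rewrite expr1 in x2; split; lra.
Qed.

Let iY31 : P.-integrable setT (EFin \o (fun w => 1 + `|Y w| ^+ 3)).
Proof.
have i1 : P.-integrable setT (EFin \o (cst 1 : T -> R)).
  by apply: (@bounded_integrable _ _ _ P _ 1) => // w /=; rewrite normr1.
exact: (integrableD measurableT i1 iY3).
Qed.

Lemma integrable_third_moment1 : P.-integrable setT (EFin \o Y).
Proof.
apply: (le_integrable _ _ _ iY31) => //; first exact/measurable_EFinP.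
move=> w _; rewrite /= lee_fin.
have [h _] := cube_ge (normr_ge0 (Y w)).
by rewrite (le_trans h)// ler_norm.
Qed.

Lemma integrable_third_moment2 :
  P.-integrable setT (EFin \o (fun w => Y w ^+ 2)).
Proof.
apply: (le_integrable _ _ _ iY31) => //.
  by apply/measurable_EFinP; exact: measurable_funX.
move=> w _; rewrite /= lee_fin.
have [_ h] := cube_ge (normr_ge0 (Y w)).
by rewrite normrX (le_trans h)// ler_norm.
Qed.

Local Notation beta := (\int[P]_w (`|Y w| ^+ 3)).
Local Notation var := (\int[P]_w (Y w ^+ 2)).

Let iZ3 t : P.-integrable setT (EFin \o (fun w => t ^+ 3 * `|Y w| ^+ 3)).
Proof. exact: (integrableZl measurableT (t ^+ 3) iY3). Qed.

Let iZ2 t : P.-integrable setT (EFin \o (fun w => t ^+ 2 / 2 * Y w ^+ 2)).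
Proof. exact: (integrableZl measurableT (t ^+ 2 / 2) integrable_third_moment2). Qed.

Let iZ1 t : P.-integrable setT (EFin \o (fun w => t * Y w)).
Proof. exact: (integrableZl measurableT t integrable_third_moment1). Qed.

Let i1 : P.-integrable setT (EFin \o (fun=> 1 : R)).
Proof. by apply: (@bounded_integrable _ _ _ P _ 1) => // w /=; rewrite normr1. Qed.

Let int1 : \int[P]_w (fun=> 1 : R) w = 1.
Proof.
rewrite Rintegral_cst// mul1r [X in fine X](_ : _ = 1%E)//.
exact: probability_setT.
Qed.

(** Since the mean is 0, [t * Y] can be subtracted inside the expectation, which leaves only the
    cubic error of the sine. *)
Lemma norm_sin_mean_le t : \int[P]_w Y w = 0 -> 0 <= t ->
  `|sin_mean P Y t| <= beta * t ^+ 3.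
Proof.
move=> Y0 t0; have iS := integrable_sinM P t mY.
have iD : P.-integrable setT (EFin \o (fun w => sin (t * Y w) - t * Y w)).
  exact: (integrableB measurableT iS (iZ1 t)).
have -> : sin_mean P Y t = \int[P]_w (sin (t * Y w) - t * Y w).
  rewrite RintegralB// [X in _ - X]RintegralZl//; last exact: integrable_third_moment1.
  by rewrite Y0 mulr0 subr0.
apply: (le_trans (le_normr_Rintegral measurableT iD)).
rewrite [leRHS]mulrC -(RintegralZl _ measurableT iY3).
apply: (le_Rintegral measurableT (integrable_norm iD) (iZ3 t)).
move=> w _; apply: (le_trans (norm_sin_sub_le _)).
by rewrite normrM exprMn (ger0_norm t0).
Qed.

Let i12 t : P.-integrable setT (EFin \o (fun w => 1 - t ^+ 2 / 2 * Y w ^+ 2)).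
Proof. exact: (integrableB measurableT i1 (iZ2 t)). Qed.

Let int12 t : \int[P]_w (1 - t ^+ 2 / 2 * Y w ^+ 2) = 1 - t ^+ 2 / 2 * var.
Proof.
rewrite RintegralB//; congr (_ - _); first exact: int1.
by rewrite RintegralZl//; exact: integrable_third_moment2.
Qed.

Lemma cos_mean_ge t : 1 - t ^+ 2 / 2 * var <= cos_mean P Y t.
Proof.
rewrite -int12.
apply: (le_Rintegral measurableT (i12 t) (integrable_cosM P t mY)) => w _.
by apply: le_trans (cos_lower _); rewrite exprMn mulrAC.
Qed.

Lemma cos_mean_le t : 0 <= t ->
  cos_mean P Y t <= 1 - t ^+ 2 / 2 * var + t ^+ 3 * beta.
Proof.
move=> t0; rewrite -int12 -(RintegralZl _ measurableT iY3) -RintegralD//.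
apply: (le_Rintegral measurableT (integrable_cosM P t mY)).
  exact: (integrableD measurableT (i12 t) (iZ3 t)).
move=> w _; apply: (le_trans (cos_upper _)).
by rewrite normrM !exprMn (ger0_norm t0) mulrAC.
Qed.

End third_moment.

(** * Normalization by scaling *)

Section centered_sums.
Context d (T : measurableType d) (R : realType) (P : probability T R).

Lemma integrable_iid_sum (X : nat -> T -> R) : iid P X ->
  P.-integrable setT (EFin \o X 0%N) ->
  forall n, P.-integrable setT (EFin \o (fun w => \sum_(k < n) X k w)).
Proof.
move=> [mX [_ idX]] iX0 n.
have iX k : P.-integrable setT (EFin \o X k).
  have [] // := @identical_Rintegral _ _ _ P (X 0%N) (X k) id (mX _) (mX _).
  by move=> B mB; rewrite idX.
elim: n => [|n IH].
  apply: (eq_integrable _ (cst 0%E)) => //; last exact: integrable0.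
  by move=> w _; rewrite /= big_ord0.
apply: eq_integrable (integrableD measurableT IH (iX n)) => // w _.
by rewrite /= big_ord_recr.
Qed.

(** Here [v] is a quarter of the variance. Of the coefficient 1/2 of [t ^+ 2 * var] in the cosine,
    the cubic error takes 1/8 and the squared sine mean 1/8, which leaves the 1/4 required by the
    modulus bound. *)
Let small_tail (X : nat -> T -> R) (m : nat) : iid P X ->
  P.-integrable setT (EFin \o (fun w => `|X 0%N w| ^+ 3)) ->
  \int[P]_w X 0%N w = 0 ->
  0 < \int[P]_w (X 0%N w ^+ 2) <= 1 ->
  \int[P]_w (`|X 0%N w| ^+ 3) <= \int[P]_w (X 0%N w ^+ 2) / 8 ->
  (64 * @tail_shift R + tail_shift ^+ 3) ^+ 2 < m%:R * (\int[P]_w (X 0%N w ^+ 2) / 4) ->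
  (P [set w | (\sum_(k < (6 * m).+2) X k w <= - tail_shift)%R] < (1 / 2)%:E)%E.
Proof.
move=> iidX iX3 X0 /andP[].
set var := \int[P]_w (X 0%N w ^+ 2); set beta := \int[P]_w (`|X 0%N w| ^+ 3).
move=> v0 v1 bv m_large.
have mX0 : measurable_fun setT (X 0%N) by case: iidX.
have b0 : 0 <= beta by apply: Rintegral_ge0 => w _; exact: exprn_ge0.
have v0' : 0 < var / 4 by lra.
apply: (@lower_tail_lt R d T P _ (var / 4) m
  (cos_mean P (X 0%N)) (sin_mean P (X 0%N))) => //.
- exact: (measurable_iid_sum iidX).
- exact: (integrable_iid_sum iidX (integrable_third_moment1 mX0 iX3)).
- by lra.
- move=> t /unit_itvP /andP[/ltW t0 _].
  apply: (le_trans (norm_sin_mean_le mX0 iX3 X0 t0)).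
  by rewrite -/beta ler_wpM2r ?exprn_ge0//; lra.
- move=> t _; apply: le_trans (cos_mean_ge mX0 iX3 t); rewrite -/var; lra.
- move=> t /unit_itvP /andP[/ltW t0 t1].
  have := norm_sin_mean_le mX0 iX3 X0 t0.
  have := cos_mean_ge mX0 iX3 t; have := cos_mean_le mX0 iX3 t0.
  rewrite -/var -/beta.
  move: (cos_mean _ _ _) (sin_mean _ _ _) => r s r_le r_ge s_le.
  have t2 : t ^+ 2 <= 1 by rewrite exprn_ile1.
  have t20 : 0 <= t ^+ 2 by rewrite sqr_ge0.
  have t3 : t ^+ 3 <= t ^+ 2 by rewrite exprS ler_piMl.
  have t30 : 0 <= t ^+ 3 by rewrite exprn_ge0.
  have tv : t ^+ 2 * var <= 1.
    by rewrite -[leRHS]mulr1 ler_pM// ltW.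
  have tv0 : 0 <= t ^+ 2 * var by rewrite mulr_ge0// ltW.
  have tb : t ^+ 3 * beta <= t ^+ 2 * (var / 8) by rewrite ler_pM.
  have r1 : r <= 1 by lra.
  have r0 : 0 <= r by lra.
  have rr : r ^+ 2 <= r by rewrite expr2 ler_piMl.
  have ss : s ^+ 2 <= t ^+ 2 * (var / 8).
    have s1 : `|s| <= t ^+ 2 * (var / 8) by rewrite (le_trans s_le)// mulrC.
    rewrite -(real_normK (num_real s)) expr2 (le_trans _ s1)// ler_piMl//; lra.
  by lra.
- by move=> t _; have [] := trig_mean_sum iidX t (6 * m).+2.
- by move=> t _; have [] := trig_mean_sum iidX t (6 * m).+2.
Qed.

Lemma iid_sum_tail (X : nat -> T -> R) : iid P X ->
  P.-integrable setT (EFin \o (fun w => `|X 0%N w| ^+ 3)) ->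
  \int[P]_w X 0%N w = 0 ->
  0 < \int[P]_w (X 0%N w ^+ 2) ->
  exists B : R, forall n0, exists2 n, (n0 <= n)%N &
    (P [set w | (\sum_(k < n) X k w <= - B)%R] < (1 / 2)%:E)%E.
Proof.
move=> iidX iX3 X0.
set var := \int[P]_w (X 0%N w ^+ 2); set beta := \int[P]_w (`|X 0%N w| ^+ 3).
move=> v0.
have mX0 : measurable_fun setT (X 0%N) by case: iidX.
have b0 : 0 <= beta by apply: Rintegral_ge0 => w _; exact: exprn_ge0.
have var2 : 0 <= var ^+ 2 by rewrite sqr_ge0.
(* Scaling by [l] multiplies the variance by [l ^+ 2] and the third moment by [l ^+ 3], so a small
   [l] makes the latter negligible. The summands of [q] give [l * beta <= var / 8], [l * var <= 1]
   and [l <= 1]. *)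
pose q := 8 * (beta + var ^+ 2 + 1); pose l := var / q.
have q0 : 0 < q by rewrite /q; lra.
have l0 : 0 < l by rewrite divr_gt0.
have lq : l * q = var by rewrite /l divfK// gt_eqF.
pose X' k w := l * X k w.
have ml : measurable_fun setT (fun x : R => l * x) by exact: measurable_funM.
have iidX' : iid P X' := iid_comp ml iidX.
have norm3 : forall w, `|X' 0%N w| ^+ 3 = l ^+ 3 * `|X 0%N w| ^+ 3.
  by move=> w; rewrite /X' normrM exprMn (gtr0_norm l0).
have sq2 : forall w, X' 0%N w ^+ 2 = l ^+ 2 * X 0%N w ^+ 2.
  by move=> w; rewrite /X' exprMn.
have iX3' : P.-integrable setT (EFin \o (fun w => `|X' 0%N w| ^+ 3)).
  apply: eq_integrable (integrableZl measurableT (l ^+ 3) iX3) => // w _.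
  by rewrite /= norm3.
have X0' : \int[P]_w X' 0%N w = 0.
  by rewrite /X' RintegralZl ?X0 ?mulr0//; exact: integrable_third_moment1.
have varE : \int[P]_w (X' 0%N w ^+ 2) = l ^+ 2 * var.
  under eq_Rintegral do rewrite sq2.
  by rewrite RintegralZl//; exact: integrable_third_moment2.
have betaE : \int[P]_w (`|X' 0%N w| ^+ 3) = l ^+ 3 * beta.
  under eq_Rintegral do rewrite norm3.
  by rewrite RintegralZl.
have l20 : 0 < l ^+ 2 by rewrite exprn_gt0.
have var0' : 0 < l ^+ 2 * var by rewrite mulr_gt0.
have lb : l * beta <= var / 8.
  rewrite -lq /q; have : 0 <= l * (var ^+ 2 + 1) by rewrite mulr_ge0//; lra.
  by lra.
have lv : l * var <= 1.
  by rewrite /l mulrAC ler_pdivrMr// mul1r -expr2 /q; lra.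
have l1 : l <= 1.
  rewrite /l ler_pdivrMr// mul1r /q.
  by have := sqr_ge0 (var - 1); lra.
have llv : l ^+ 2 * var <= 1 by rewrite expr2 -mulrA mulr_ile1// ltW// mulr_gt0.
exists (tail_shift / l) => n0.
pose t := (64 * @tail_shift R + tail_shift ^+ 3) ^+ 2 / (l ^+ 2 * var / 4).
(* [n0] makes the index large enough, and the Archimedean bound provides the size of [m] needed by
   [small_tail]. *)
pose m := maxn n0 (Num.bound t).
exists (6 * m).+2.
  apply: (leq_trans (leq_maxl n0 (Num.bound t))); rewrite -/m.
  by rewrite -addn2 (leq_trans _ (leq_addr _ _))// leq_pmull.
have t0 : 0 <= t by rewrite divr_ge0 ?sqr_ge0// divr_ge0// ltW.
rewrite (_ : [set w | _] = [set w | \sum_(k < (6 * m).+2) X' k w <= - tail_shift]).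
  apply: small_tail => //; rewrite varE ?betaE.
  - by rewrite var0'.
  - rewrite exprS -mulrA [l * (_ * _)]mulrCA -[leRHS]mulrA.
    by rewrite ler_wpM2l ?(ltW l20).
  - have c0 : 0 < l ^+ 2 * var / 4 by rewrite divr_gt0.
    rewrite -ltr_pdivrMr// -/t; apply: (lt_le_trans (archi_boundP t0)).
    by rewrite ler_nat leq_maxr.
have E w : (\sum_(k < (6 * m).+2) X k w <= - (tail_shift / l)) =
    (\sum_(k < (6 * m).+2) X' k w <= - tail_shift).
  by rewrite -mulr_sumr -[- (tail_shift / l)]mulNr ler_pdivlMr// mulrC.
by apply/seteqP; split => w /=; rewrite E.
Qed.

End centered_sums.

(** * Chebyshev's inequality for centered sums *)

Section weak_law.
Context d (T : measurableType d) (R : realType) (P : probability T R).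
Variable X : nat -> T -> R.
Hypothesis iidX : iid P X.
Hypothesis iX : P.-integrable setT (EFin \o X 0%N).
Hypothesis iX2 : P.-integrable setT (EFin \o (fun w => X 0%N w ^+ 2)).
Hypothesis X0 : \int[P]_w X 0%N w = 0.

(** In the square of [S n + X n] the cross term factors by independence and vanishes by
    centering. *)
Lemma iid_sum_second_moment n :
  P.-integrable setT (EFin \o (fun w => (\sum_(k < n) X k w) ^+ 2)) /\
  \int[P]_w ((\sum_(k < n) X k w) ^+ 2) = n%:R * \int[P]_w (X 0%N w ^+ 2).
Proof.
have [mX [indX idX]] := iidX.
have law k (B : set R) : measurable B -> P (X 0%N @^-1` B) = P (X k @^-1` B).
  by move=> mB; rewrite idX.
elim: n => [|n [IHi IHE]].
  have S0 w : (\sum_(k < 0) X k w) ^+ 2 = 0 by rewrite big_ord0 expr0n.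
  split; last first.
    under eq_Rintegral do rewrite S0.
    by rewrite Rintegral_cst// !mul0r.
  apply: (@bounded_integrable _ _ _ P _ 0) => [|w]; last by rewrite S0 normr0.
  by apply: measurable_funX; exact: (measurable_iid_sum iidX).
have m2 : measurable_fun setT (fun x : R => x ^+ 2) by exact: measurable_funX.
have [iXn2 Xn2E] := identical_Rintegral (mX _) (mX n) m2 (law n) iX2.
have [iXn XnE] := identical_Rintegral (mX _) (mX n) (@measurable_id _ _ setT) (law n) iX.
have iS := integrable_iid_sum iidX iX n.
have [iSX SXE] := indep2_RintegralM (measurable_iid_sum iidX n) (mX n)
  (@sum_indep_next _ _ _ P X mX indX n) iS iXn.
have {}SXE : \int[P]_w ((\sum_(k < n) X k w) * X n w) = 0.
  by rewrite SXE [X in _ * X]XnE X0 mulr0.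
pose f w := (\sum_(k < n) X k w) ^+ 2 + 2 * ((\sum_(k < n) X k w) * X n w).
have i2 := integrableZl measurableT 2 iSX.
have if' : P.-integrable setT (EFin \o f) := integrableD measurableT IHi i2.
have E w : (\sum_(k < n.+1) X k w) ^+ 2 = f w + X n w ^+ 2.
  by rewrite big_ord_recr/= /f; ring.
split.
  by apply: eq_integrable (integrableD measurableT if' iXn2) => // w _; rewrite /= E.
under eq_Rintegral do rewrite E.
rewrite RintegralD// Xn2E /f RintegralD// RintegralZl// SXE IHE -natr1.
by ring.
Qed.

Lemma iid_sum_upper_tail n (c : R) : 0 < c ->
  (P [set w | (c <= \sum_(k < n) X k w)%R] <=
    (n%:R * \int[P]_w (X 0%N w ^+ 2) / c ^+ 2)%:E)%E.
Proof.
move=> c0; have [iS2 S2E] := iid_sum_second_moment n.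
set A := [set w | _].
have mA : measurable A.
  rewrite (_ : A = (fun w => \sum_(k < n) X k w) @^-1` `[c, +oo[%classic); last first.
    by apply/seteqP; split => w; rewrite /A/= in_itv/= andbT.
  by rewrite -[X in measurable X]setTI; exact: (measurable_iid_sum iidX).
have iA : P.-integrable setT (EFin \o (\1_A : T -> R)).
  apply: (@bounded_integrable _ _ _ P _ 1); first exact: measurable_indic.
  by move=> w; rewrite indicE; case: (w \in A); rewrite ?normr1 ?normr0.
have PA : P A \is a fin_num by rewrite fin_num_measure.
have intA : \int[P]_w (\1_A w : R) = fine (P A).
  by rewrite /Rintegral integral_indic// setIT.
have c2 : 0 < c ^+ 2 by rewrite exprn_gt0.
rewrite -(fineK PA) lee_fin ler_pdivlMr// -S2E mulrC -intA -RintegralZl//.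
apply: (le_Rintegral measurableT (integrableZl measurableT (c ^+ 2) iA) iS2).
move=> w _; rewrite indicE; have [wA|wA] := boolP (w \in A); last first.
  by rewrite mulr0 sqr_ge0.
have := set_mem wA; rewrite /A/= mulr1 => cS.
by rewrite lerXn2r ?nnegrE ?(ltW c0)// (le_trans (ltW c0)).
Qed.

End weak_law.

(** * Null sets and positivity of the variance *)

Section almost_sure.
Context d (T : measurableType d) (R : realType) (P : probability T R).

Lemma le_probability_ae (N A B : set T) : measurable N -> P N = 0%E ->
  measurable A -> measurable B -> (forall w, ~ N w -> A w -> B w) ->
  (P A <= P B)%E.
Proof.
move=> mN PN mA mB AB.
apply: (@le_trans _ _ (P (B `|` N))).
  apply: le_measure; rewrite ?inE//; first exact: measurableU.
  by move=> w Aw; have [Nw|/AB Bw] := pselect (N w); [right|left; exact: Bw].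
by have := @measureU2 _ _ _ P _ _ mB mN; rewrite [X in (_ + X)%E]PN adde0.
Qed.

Lemma nonlattice_variance_gt0 (Y : T -> R) (mean : R) :
  measurable_fun setT Y ->
  P.-integrable setT (EFin \o (fun w => (Y w - mean) ^+ 2)) ->
  ~ lattice_distributed P Y -> 0 < \int[P]_w ((Y w - mean) ^+ 2).
Proof.
move=> mY iY2 nonlat.
rewrite lt_neqAle; apply/andP; split; last first.
  by apply: Rintegral_ge0 => w _; exact: sqr_ge0.
(* With zero variance [Y] is almost surely the constant [mean]; a point mass is lattice with base
   [mean], step 1 and integer 0. *)
apply/eqP => var0; apply: nonlat; exists mean, 1; split => //.
have int0 : (\int[P]_w `|((Y w - mean) ^+ 2)%:E| = 0)%E.
  rewrite -[RHS]/(0%:E) var0 /Rintegral fineK; last exact: integrable_fin_num.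
  by apply: eq_integral => w _; rewrite gee0_abs// lee_fin sqr_ge0.
have [N [mN PN sub]] : {ae P, forall w, setT w -> ((Y w - mean) ^+ 2)%:E = 0%E}.
  apply/ae_eq_integral_abs => //; apply/measurable_EFinP.
  by apply: measurable_funX; exact: measurable_funB.
set L := [set w | _].
have mL : measurable L.
  (* The lattice event is the preimage of a countable, hence measurable, set. *)
  pose Q := range (fun z : int => mean + z%:~R * 1).
  have mQ : measurable Q.
    apply: countable_measurable => [x|]; first exact: measurable_set1.
    by apply: sub_countable (card_image_le _ _) _; exact: countableP.
  rewrite (_ : L = Y @^-1` Q).
    by rewrite -[X in measurable X]setTI; exact: mY.
  apply/seteqP; split => w /= [z]; first by move=> ->; exists z.
  by move=> _ e; exists z; rewrite e.
apply/eqP; rewrite eq_le probability_le1//= -(@probability_setT _ _ _ P).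
apply: (le_probability_ae mN PN) => // w Nw _; apply: contrapT => Lw.
apply: Nw; apply: sub => /=.
apply/not_implyP; split => // /eqP; rewrite eqe sqrf_eq0 subr_eq0 => /eqP Yw.
by apply: Lw; exists 0; rewrite mul0r addr0.
Qed.

End almost_sure.

Section half_lines.
Context d (T : measurableType d) (R : realType).

Lemma measurable_le_cst (Y : T -> R) x : measurable_fun setT Y ->
  measurable [set w | Y w <= x].
Proof.
move=> mY; rewrite (_ : [set w | _] = Y @^-1` `]-oo, x]%classic).
  by rewrite -[X in measurable X]setTI; exact: mY.
by apply/seteqP; split => w; rewrite /= in_itv.
Qed.

Lemma measurable_ge_cst (Y : T -> R) x : measurable_fun setT Y ->
  measurable [set w | x <= Y w].
Proof.
move=> mY; rewrite (_ : [set w | _] = Y @^-1` `[x, +oo[%classic).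
  by rewrite -[X in measurable X]setTI; exact: mY.
by apply/seteqP; split => w; rewrite /= in_itv/= andbT.
Qed.

End half_lines.

(** * From products to sums of logarithms *)

Section products.
Context d (T : measurableType d) (R : realType) (P : probability T R).
Variable a : nat -> T -> R.
Hypothesis iida : iid P a.
Hypothesis a_gt0 : forall k, P [set w | 0 < a k w] = 1%E.

(** Each factor is positive only almost surely. Outside this null set all factors are positive at
    once, and the logarithm of the product is the sum of the logarithms. *)
Let N := \bigcup_k ~` [set w | 0 < a k w].

Let ma k : measurable_fun setT (a k). Proof. by case: iida. Qed.

Let mpos k : measurable [set w | 0 < a k w].
Proof.
rewrite (_ : [set w | _] = a k @^-1` `]0, +oo[%classic).
  by rewrite -[X in measurable X]setTI; exact: ma.
by apply/seteqP; split => w; rewrite /= in_itv/= andbT.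
Qed.

Let mN : measurable N.
Proof. by apply: bigcupT_measurable => k; exact: measurableC. Qed.

Let PN : P N = 0%E.
Proof.
apply/negligibleP => //; apply: negligible_bigcup => k.
apply/negligibleP; first exact: measurableC.
by have := @probability_setC _ _ _ P _ (mpos k); rewrite a_gt0 subee.
Qed.

Let posN w : ~ N w -> forall k, 0 < a k w.
Proof. by move=> Nw k; apply: contrapT => ak; apply: Nw; exists k. Qed.

Let prod_gt0 w n : ~ N w -> 0 < \prod_(k < n) a k w.
Proof. by move=> /posN aw; apply: prodr_gt0. Qed.

Let ln_prod w n : ~ N w -> ln (\prod_(k < n) a k w) = \sum_(k < n) ln (a k w).
Proof.
move=> Nw; elim: n => [|n IH]; first by rewrite !big_ord0 ln1.
by rewrite !big_ord_recr/= lnM ?posrE ?IH//; [exact: prod_gt0|exact: posN].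
Qed.

Let mprod n : measurable_fun setT (fun w => \prod_(k < n) a k w).
Proof. exact: measurable_prod. Qed.

Let msum n : measurable_fun setT (fun w => \sum_(k < n) ln (a k w)).
Proof.
by apply: measurable_sum => k; apply: measurableT_comp => //; exact: measurable_ln.
Qed.

Lemma prod_le_sum_ln n (x y : R) : x <= expR y ->
  (P [set w | (\prod_(k < n) a k w <= x)%R] <=
   P [set w | (\sum_(k < n) ln (a k w) <= y)%R])%E.
Proof.
move=> xy; apply: (le_probability_ae mN PN); [exact: measurable_le_cst|exact: measurable_le_cst|].
move=> w Nw /= wx; rewrite -ln_prod// -(expRK y) ler_ln ?posrE ?expR_gt0 ?prod_gt0//.
exact: le_trans wx xy.
Qed.

Lemma prod_ge_sum_ln n (x y : R) : expR y <= x ->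
  (P [set w | (x <= \prod_(k < n) a k w)%R] <=
   P [set w | (y <= \sum_(k < n) ln (a k w))%R])%E.
Proof.
move=> xy; apply: (le_probability_ae mN PN); [exact: measurable_ge_cst|exact: measurable_ge_cst|].
move=> w Nw /= wx; rewrite -ln_prod// -(expRK y) ler_ln ?posrE ?expR_gt0 ?prod_gt0//.
exact: le_trans xy wx.
Qed.

(** At a nonpositive [x] the lower half of the median condition would give a null event probability
    1/2. *)
Lemma median_prod_gt0 n x : is_median P (fun w => \prod_(k < n) a k w) x -> 0 < x.
Proof.
move=> [half _]; rewrite ltNge; apply/negP => x0.
have : (P [set w | (\prod_(k < n) a k w <= x)%R] <= P set0)%E.
  apply: (le_probability_ae mN PN) => //; first exact: measurable_le_cst.
  by move=> w /(@prod_gt0 _ n) p0 /= px; move: (lt_le_trans p0 px); rewrite ltNge x0.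
rewrite measure0 => /(le_trans half); rewrite lee_fin; lra.
Qed.

End products.

(** * The equivalence for medians *)

Theorem theorem4 (d : measure_display) (T : measurableType d) (R : realType)
  (P : probability T R) (a : nat -> T -> R) :
  iid P a ->
  (forall k, P [set w | 0 < a k w] = 1%E) ->
  ~ lattice_distributed P (fun w => ln (a 0%N w)) ->
  (\int[P]_w (`|ln (a 0%N w)| ^+ 3)%:E < +oo)%E ->
  forall m : nat -> R,
    (forall K, is_median P (fun w => \prod_(k < K) a k w) (m K)) ->
    (m @ \oo --> 0 <-> (\int[P]_w (ln (a 0%N w))%:E < 0)%E).
Proof.
move=> iida a_gt0 nonlat fin3 m med.
have ma : measurable_fun setT (a 0%N) by case: iida.
have mln : measurable_fun setT (fun w => ln (a 0%N w)).
  by apply: measurableT_comp => //; exact: measurable_ln.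
have i3 : P.-integrable setT (EFin \o (fun w => `|ln (a 0%N w)| ^+ 3)).
  apply/integrableP; split.
    by apply/measurable_EFinP; apply: measurable_funX; exact: measurableT_comp.
  rewrite (eq_integral (fun w => (`|ln (a 0%N w)| ^+ 3)%:E))// => w _.
  by rewrite gee0_abs// lee_fin exprn_ge0.
have i1 := integrable_third_moment1 mln i3.
pose mean := \int[P]_w ln (a 0%N w).
have -> : (\int[P]_w (ln (a 0%N w))%:E)%E = mean%:E.
  by rewrite /mean /Rintegral fineK//; exact: integrable_fin_num.
rewrite lte_fin.
pose X k w := ln (a k w) - mean.
have mg : measurable_fun setT (fun x : R => ln x - mean).
  by apply: measurable_funB => //; exact: measurable_ln.
have iidX : iid P X := iid_comp mg iida.
have mX0 : measurable_fun setT (X 0%N) by case: iidX.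
have icst (c : R) : P.-integrable setT (EFin \o (fun=> c)).
  by apply: (@bounded_integrable _ _ _ P _ `|c|).
have iX3 : P.-integrable setT (EFin \o (fun w => `|X 0%N w| ^+ 3)).
  have i4 : P.-integrable setT
      (EFin \o (fun w => 4 * (`|ln (a 0%N w)| ^+ 3 + `|mean| ^+ 3))).
    exact: (integrableZl measurableT 4 (integrableD measurableT i3 (icst (`|mean| ^+ 3)))).
  apply: (le_integrable _ _ _ i4) => //.
    by apply/measurable_EFinP; apply: measurable_funX; exact: measurableT_comp.
  move=> w _; rewrite /= lee_fin (ger0_norm (exprn_ge0 _ _))//.
  apply: le_trans (ler_norm _).
  apply: (@le_trans _ _ ((`|ln (a 0%N w)| + `|mean|) ^+ 3)).
    by rewrite lerXn2r ?nnegrE ?addr_ge0// ler_normB.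
  move: (normr_ge0 (ln (a 0%N w))) (normr_ge0 mean).
  move: `|ln _| `|mean| => p q p0 q0.
  (* [4 * (p ^+ 3 + q ^+ 3) - (p + q) ^+ 3] is three times this product. *)
  have : 0 <= (p + q) * (p - q) ^+ 2 by rewrite mulr_ge0 ?sqr_ge0 ?addr_ge0.
  by lra.
have iX := integrable_third_moment1 mX0 iX3.
have iX2 := integrable_third_moment2 mX0 iX3.
have X0 : \int[P]_w X 0%N w = 0.
  rewrite /X RintegralB// Rintegral_cst// [X in _ * fine X](_ : _ = 1%E).
    by rewrite mulr1 subrr.
  exact: probability_setT.
have sumX n w : \sum_(k < n) X k w = \sum_(k < n) ln (a k w) - n%:R * mean.
  by rewrite sumrB sumr_const card_ord mulr_natl.
have var0 : 0 < \int[P]_w (X 0%N w ^+ 2) by exact: nonlattice_variance_gt0.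
have mSX n : measurable_fun setT (fun w => \sum_(k < n) X k w).
  exact: (measurable_iid_sum iidX).
have mSln n : measurable_fun setT (fun w => \sum_(k < n) ln (a k w)).
  exact: (measurable_iid_sum (iid_comp (@measurable_ln R) iida)).
split.
- move=> /cvgr0Pnorm_lt cvgm; rewrite ltNge; apply/negP => mean_ge0.
  (* Convergence puts every late median below [expR (- B)], so the sum of logarithms is at most
     [- B] with probability at least 1/2; some late [n] contradicts this. *)
  have [B tailB] := iid_sum_tail iidX iX3 X0 var0.
  have [n0 _ n0P] := cvgm (expR (- B)) (expR_gt0 _).
  have [n n0n Pn] := tailB n0.
  have mn : m n <= expR (- B) by rewrite (le_trans (ler_norm _))// ltW// n0P.
  have [half _] := med n.
  have := le_trans half (prod_le_sum_ln iida a_gt0 n mn).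
  apply/negP; rewrite -ltNge; apply: le_lt_trans Pn.
  apply: le_measure; rewrite ?inE.
  + exact: (measurable_le_cst _ (mSln n)).
  + exact: (measurable_le_cst _ (mSX n)).
  (* The drift [n%:R * mean] is nonnegative, so centering only lowers the sum. *)
  move=> w /= Sw; rewrite sumX; have : 0 <= n%:R * mean by rewrite mulr_ge0.
  by lra.
- move=> mean_lt0; apply/cvgr0Pnorm_lt => e e0.
  set var := \int[P]_w (X 0%N w ^+ 2) in var0.
  (* Beyond [n1] the level [ln e] costs less than half of the drift; beyond [n2] the Chebyshev bound
     [4 * var / (n * mean ^+ 2)] at the other half is below 1/2. *)
  pose n1 := Num.bound (`|ln e| / (- mean / 2)).
  pose n2 := Num.bound (8 * var / mean ^+ 2).
  exists (maxn n1 n2) => // n /= n12.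
  have mn0 := median_prod_gt0 iida a_gt0 (med n).
  rewrite gtr0_norm// ltNge; apply/negP => emn.
  have [_ half] := med n.
  have elne : expR (ln e) <= m n by rewrite lnK ?posrE.
  have := le_trans half (prod_ge_sum_ln iida a_gt0 n elne).
  apply/negP; rewrite -ltNge.
  have h1 : `|ln e| < n%:R * (- mean / 2).
    rewrite -ltr_pdivrMr; last by lra.
    apply: lt_le_trans (archi_boundP _) _; first by apply: divr_ge0 => //; lra.
    by rewrite ler_nat (leq_trans _ n12)// leq_maxl.
  have h2 : 8 * var < n%:R * mean ^+ 2.
    have m2 : 0 < mean ^+ 2 by rewrite exprn_even_gt0//= lt_eqF.
    rewrite -ltr_pdivrMr//.
    apply: lt_le_trans (archi_boundP _) _; first by apply: divr_ge0; [lra|exact: ltW].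
    by rewrite ler_nat (leq_trans _ n12)// leq_maxr.
  pose c := n%:R * (- mean / 2).
  have c0 : 0 < c := le_lt_trans (normr_ge0 _) h1.
  apply: (@le_lt_trans _ _ (P [set w | (c <= \sum_(k < n) X k w)%R])).
    apply: le_measure; rewrite ?inE.
    + exact: (measurable_ge_cst _ (mSln n)).
    + exact: (measurable_ge_cst _ (mSX n)).
    move=> w /= Sw; rewrite sumX /c; have := ler_norm (- ln e); rewrite normrN.
    by lra.
  apply: (le_lt_trans (iid_sum_upper_tail iidX iX iX2 X0 n c0)).
  rewrite lte_fin ltr_pdivrMr ?exprn_gt0// -/var /c.
  have n0 : 0 < n%:R :> R.
    rewrite lt_neqAle ler0n andbT eq_sym; apply/eqP => n0.
    by move: c0; rewrite /c n0 mul0r ltxx.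
  have := ltr_pM2l n0.
  move=> /(_ (8 * var) (n%:R * mean ^+ 2)); rewrite h2 => h3.
  have : n%:R * (8 * var) < n%:R * (n%:R * mean ^+ 2) by rewrite h3.
  by lra.
Qed.
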